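(* The two KZ-machines $\mathcal{E}_h$ and $\mathcal{E}_h^{(2)}$ on $\mathfrak{Lex}$ are Morita equivalent. That is, a lex category is $\mathcal{E}_h$-cocomplete if and only if it is $\mathcal{E}_h^{(2)}$-cocomplete, and a lex functor between such lex categories is $\mathcal{E}_h$-linear if and only if it is $\mathcal{E}_h^{(2)}$-linear.
   Context: $\mathfrak{Lex}$ is the strict 2-category of lex categories (locally small categories with finite limits, whose set of objects is contained in a fixed universe), lex functors (functors preserving finite limits) and natural transformations. Kan extensions. In a 2-category (i.e. bicategory), a left Kan extension of $f:X\to Z$ along $p:X\to Y$ is a morphism $p_!(f):Y\to Z$ with a 2-morphism $f\to p_!(f)\circ p$ such that for every $g:Y\to Z$ and every 2-morphism $f\to g\circ p$ there is a unique 2-morphism $p_!(f)\to g$ through which it factors as $f\to p_!(f)\circ p\to g\circ p$. KZ-machines. A KZ-machine $P$ on a 2-category $\mathfrak{C}$ is the data, for every object $X$, of an object $P(X)$ and a morphism $i_P(X):X\to P(X)$ such that: for every $f:X\to Y$, the morphism $i_P(Y)\circ f$ has a left Kan extension $P(f)$ along $i_P(X)$ and the 2-morphism $i_P(Y)\circ f\to P(f)\circ i_P(X)$ is invertible; and the canonical 2-morphisms $P(g\circ f)\to P(g)\circ P(f)$ and $P(\mathrm{Id}_X)\to \mathrm{Id}_{P(X)}$ are invertible. An object $Y$ is $P$-cocomplete (a $P$-algebra) if every $f:X\to Y$ has a left Kan extension $\overline{f}$ along $i_P(X)$ with $f\to\overline{f}\circ i_P(X)$ invertible, and for every $g:X'\to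 X$ the canonical 2-morphism $\overline{f\circ g}\to\overline{f}\circ P(g)$ is invertible. Put $m_P(Y)=\overline{\mathrm{Id}_Y}$. A morphism $f:X\to Y$ between $P$-cocomplete objects is $P$-linear if the canonical 2-morphism $\overline{f}\to f\circ m_P(X)$ is invertible. Equivalence 2-groupoids. Let $\mathsf{C}$ be a lex category. An equivalence 2-groupoid $A$ in $\mathsf{C}$ consists of objects $A_0,A_1$ and morphisms $d_0,d_1:A_1\to A_0$, $\sigma:A_0\to A_1$ with $d_0\sigma=d_1\sigma=\mathrm{Id}$, such that the associated 1-coskeletal simplicial object is Kan; equivalently, there exist (unspecified) morphisms $c:A_1\times_{A_0}A_1\to A_1$ (pullback of $d_1$ on the first factor and $d_0$ on the second) with $d_0c=d_0\pi_1$, $d_1c=d_1\pi_2$, and $\tau:A_1\to A_1$ with $d_0\tau=d_1$, $d_1\tau=d_0$. The category $\mathcal{E}^{(2)}(\mathsf{C})$ has equivalence 2-groupoids as objects; a morphism $A\to B$ is a pair $f_0:A_0\to B_0$, $f_1:A_1\to B_1$ with $(d_0,d_1)\circ f_1=(f_0\times f_0)\circ(d_0,d_1)$ (no compatibility with $\sigma$ is required). Two morphisms $f,g:A\to B$ are homotopic if $(f_0,g_0):A_0\to B_0\times B_0$ factors through $(d_0,d_1):B_1\to B_0\times B_0$; $\mathcal{E}_h^{(2)}(\mathsf{C})$ is the quotient category of $\mathcal{E}^{(2)}(\mathsf{C})$ identifying homotopic morphisms. $\mathcal{E}_h(\mathsf{C})$ is its full subcategory spanned by the equivalence groupoids, i.e.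 those $A$ with $(d_0,d_1):A_1\to A_0\times A_0$ monic. Both are lex; the unit embeddings from $\mathsf{C}$ send $X$ to $(X,X)$ with identity structure maps, and these data make $\mathcal{E}_h$ and $\mathcal{E}_h^{(2)}$ KZ-machines on $\mathfrak{Lex}$, acting on a lex functor $F$ by $(A_0,A_1)\mapsto(F(A_0),F(A_1))$. *)

(* Defs.v *)
From Stdlib Require List.
From mathcomp Require Import all_boot.
From mathcomp Require Import boolp classical_sets cardinality.

Set Implicit Arguments.
Unset Strict Implicit.
Unset Printing Implicit Defensive.

Declare Scope cat_scope.
Delimit Scope cat_scope with cat.
Local Open Scope cat_scope.

Record category := Category {
  obj :> Type;
  hom : obj -> obj -> Type;
  idm : forall x, hom x x;
  comp : forall x y z, hom y z -> hom x y -> hom x z;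
  comp_idl : forall x y (f : hom x y), comp (idm y) f = f;
  comp_idr : forall x y (f : hom x y), comp f (idm x) = f;
  compA : forall w x y z (h : hom y z) (g : hom x y) (f : hom w x),
    comp h (comp g f) = comp (comp h g) f }.

Arguments hom {c} x y : rename, simpl never.
Arguments idm {c} x : rename, simpl never.
Arguments comp {c x y z} g f : rename, simpl never.
Arguments comp_idl {c x y} f : rename.
Arguments comp_idr {c x y} f : rename.
Arguments compA {c w x y z} h g f : rename.

Notation "g ∘ f" := (comp g f) (at level 40, left associativity) : cat_scope.

Record functor (C D : category) := Functor {
  fobj :> C -> D;
  fmap : forall x y, hom x y -> hom (fobj x) (fobj y);
  fmap_id : forall x, fmap (idm x) = idm (fobj x);
  fmap_comp : forall x y z (g : hom y z) (f : hom x y),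
    fmap (g ∘ f) = fmap g ∘ fmap f }.

Arguments fmap {C D} f {x y} u : rename.
Arguments fmap_id {C D} f x : rename.
Arguments fmap_comp {C D} f {x y z} g u : rename.

Record nat_trans (C D : category) (F G : functor C D) := NatTrans {
  ncomp :> forall x, hom (F x) (G x);
  ncompE : forall x y (f : hom x y), ncomp y ∘ fmap F f = fmap G f ∘ ncomp x }.

Arguments ncompE {C D F G} n {x y} f : rename.

Lemma nat_trans_ext (C D : category) (F G : functor C D) (a b : nat_trans F G) :
  (forall x, a x = b x) -> a = b.
Proof.
case: a b => a na [b nb] /= e.
have {}e : a = b by apply: functional_extensionality_dep.
by subst b; congr NatTrans; apply: Prop_irrelevance.
Qed.

Definition functor_id (C : category) : functor C C :=
  @Functor C C id (fun _ _ f => f) (fun _ => erefl) (fun _ _ _ _ _ => erefl).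

Section FunctorComp.
Variables (C D E : category) (G : functor D E) (F : functor C D).
Lemma functor_comp_id x : fmap G (fmap F (idm x)) = idm (G (F x)).
Proof. by rewrite !fmap_id. Qed.
Lemma functor_comp_comp x y z (g : hom y z) (f : hom x y) :
  fmap G (fmap F (g ∘ f)) = fmap G (fmap F g) ∘ fmap G (fmap F f).
Proof. by rewrite !fmap_comp. Qed.
Definition functor_comp : functor C E :=
  @Functor C E (fun x => G (F x)) (fun _ _ f => fmap G (fmap F f))
    functor_comp_id functor_comp_comp.
End FunctorComp.

Definition monic (C : category) (x y : C) (m : hom x y) :=
  forall w (u v : hom w x), m ∘ u = m ∘ v -> u = v.

Section FullSubcategory.
Variables (C : category) (P : C -> Prop).
Definition full_subcategory : category :=
  @Category {x : C | P x} (fun x y => hom (sval x) (sval y))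
    (fun x => idm (sval x)) (fun _ _ _ g f => g ∘ f)
    (fun _ _ f => comp_idl f) (fun _ _ f => comp_idr f)
    (fun _ _ _ _ h g f => compA h g f).
End FullSubcategory.

(* Morphisms are equivalence classes, as a subtype of the predicates on [hom x y],
   so that the universe of morphisms is not tied to that of objects. *)
Section QuotientCategory.
Variables (C : category) (R : forall x y : C, hom x y -> hom x y -> Prop).
Hypothesis R_refl : forall x y (f : hom x y), R f f.
Hypothesis R_sym : forall x y (f g : hom x y), R f g -> R g f.
Hypothesis R_trans : forall x y (f g h : hom x y), R f g -> R g h -> R f h.
Hypothesis R_comp : forall x y z (g g' : hom y z) (f f' : hom x y),
  R g g' -> R f f' -> R (g ∘ f) (g' ∘ f').

Section Hom.
Variables x y : C.
Definition quot_hom := {c : hom x y -> Prop | exists f, c = R f}.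
Lemma quot_hom_ext (c d : quot_hom) : sval c = sval d -> c = d.
Proof.
by case: c d => c p [d q] /= e; subst d; congr exist; apply: Prop_irrelevance.
Qed.
Definition quot_class (f : hom x y) : quot_hom := exist _ (R f) (ex_intro _ f erefl).
Definition quot_repr (c : quot_hom) : hom x y := sval (cid (svalP c)).
Lemma quot_classP (f g : hom x y) : quot_class f = quot_class g <-> R f g.
Proof.
split=> [/(congr1 sval) /= -> //|fg]; apply: quot_hom_ext => /=.
by apply/funext => h; apply/propext; split=> [/(R_trans (R_sym fg))|/(R_trans fg)].
Qed.
Lemma quot_reprK c : quot_class (quot_repr c) = c.
Proof. by apply: quot_hom_ext; rewrite /quot_repr; case: cid. Qed.
Lemma quot_classW (P : quot_hom -> Prop) :
  (forall f, P (quot_class f)) -> forall c, P c.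
Proof. by move=> h c; rewrite -[c]quot_reprK. Qed.
End Hom.

Definition quot_comp x y z (g : quot_hom y z) (f : quot_hom x y) : quot_hom x z :=
  quot_class (quot_repr g ∘ quot_repr f).

Lemma quot_compE x y z (g : hom y z) (f : hom x y) :
  quot_comp (quot_class g) (quot_class f) = quot_class (g ∘ f).
Proof.
by apply/quot_classP; apply: R_comp; apply/quot_classP; rewrite quot_reprK.
Qed.

Lemma quot_comp_idl x y (f : quot_hom x y) : quot_comp (quot_class (idm y)) f = f.
Proof. by elim/quot_classW: f => f; rewrite quot_compE comp_idl. Qed.
Lemma quot_comp_idr x y (f : quot_hom x y) : quot_comp f (quot_class (idm x)) = f.
Proof. by elim/quot_classW: f => f; rewrite quot_compE comp_idr. Qed.
Lemma quot_compA w x y z (h : quot_hom y z) (g : quot_hom x y) (f : quot_hom w x) :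
  quot_comp h (quot_comp g f) = quot_comp (quot_comp h g) f.
Proof.
elim/quot_classW: f => f; elim/quot_classW: g => g; elim/quot_classW: h => h.
by rewrite !quot_compE compA.
Qed.

Definition quotient_category : category :=
  Category quot_comp_idl quot_comp_idr quot_compA.
End QuotientCategory.

Section Cones.
Variables (J C : category) (D : functor J C).

Record cone := Cone {
  apex : C;
  leg : forall j, hom apex (D j);
  legE : forall i j (u : hom i j), fmap D u ∘ leg i = leg j }.

Definition is_limit (L : cone) := forall K : cone,
  exists! u : hom (apex K) (apex L), forall j, leg L j ∘ u = leg K j.
End Cones.

Definition finite_category (J : category) :=
  finite_set [set: J] /\ forall i j : J, finite_set [set: @hom J i j].

Definition has_finite_limits (C : category) :=
  forall J, finite_category J -> forall D : functor J C,
  exists L : cone D, is_limit L.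

Section ConeImage.
Variables (C E : category) (F : functor C E) (J : category) (D : functor J C).
Lemma fmap_legE (L : cone D) i j (u : hom i j) :
  fmap (functor_comp F D) u ∘ fmap F (leg L i) = fmap F (leg L j).
Proof. by rewrite /= -fmap_comp legE. Qed.
Definition fmap_cone (L : cone D) : cone (functor_comp F D) :=
  @Cone _ _ (functor_comp F D) (F (apex L)) (fun j => fmap F (leg L j))
    (@fmap_legE L).
End ConeImage.

Definition preserves_finite_limits (C E : category) (F : functor C E) :=
  forall J, finite_category J -> forall (D : functor J C) (L : cone D),
  is_limit L -> is_limit (fmap_cone F L).

Definition is_terminal (C : category) (t : C) := forall x, exists! u : hom x t, True.

Record span (C : category) (x y : C) := Span {
  sapex :> C; sfst : hom sapex x; ssnd : hom sapex y }.

Definition is_product (C : category) (x y : C) (s : span x y) :=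
  forall w (a : hom w x) (b : hom w y),
  exists! u : hom w s, sfst s ∘ u = a /\ ssnd s ∘ u = b.

Definition is_pullback (C : category) (x y z : C) (f : hom x z) (g : hom y z)
    (s : span x y) :=
  f ∘ sfst s = g ∘ ssnd s /\
  forall w (a : hom w x) (b : hom w y), f ∘ a = g ∘ b ->
  exists! u : hom w s, sfst s ∘ u = a /\ ssnd s ∘ u = b.

Definition fmap_span (C D : category) (F : functor C D) (x y : C) (s : span x y) :
  span (F x) (F y) := Span (fmap F (sfst s)) (fmap F (ssnd s)).

Lemma finite_set_list (T : Type) :
  finite_set [set: T] -> exists s : seq T, forall x, List.In x s.
Proof.
move=> /(@finite_seqP {classic T}) [s sT]; exists s => x.
have : [set` s]%classic x by rewrite -sT.
rewrite /= => {sT}; elim: s => // a s IH; rewrite inE => /orP [/eqP ->|/IH]; first by left.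
by right.
Qed.

Section FiniteLimitsFromPullbacks.
Variables (C E : category) (F : functor C E).
Hypothesis FT : exists t : C, is_terminal t /\ is_terminal (F t).
Hypothesis FP : forall (x y z : C) (f : hom x z) (g : hom y z),
  exists s, is_pullback f g s /\ is_pullback (fmap F f) (fmap F g) (fmap_span F s).

Lemma fp_product (x y : C) :
  exists s : span x y, is_product s /\ is_product (fmap_span F s).
Proof.
have [t [tt Ft]] := FT.
have [a _] := tt x; have [b _] := tt y.
have [s [[_ sp] [_ Fs]]] := FP a b; exists s; split.
  move=> w c d; apply: sp.
  by have [u [_ uu]] := tt w; rewrite -(uu (a ∘ c) I) -(uu (b ∘ d) I).
move=> w c d; apply: Fs.
by have [u [_ uu]] := Ft w; rewrite -(uu (fmap F a ∘ c) I) -(uu (fmap F b ∘ d) I).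
Qed.

Definition is_equalizer (K : category) (k x y : K) (f g : hom x y) (e : hom k x) :=
  f ∘ e = g ∘ e /\ forall w (a : hom w x), f ∘ a = g ∘ a -> exists! u, e ∘ u = a.

Lemma equalizer_of_pullback (K : category) (x y : K) (f g : hom x y)
    (p : span y y) (fg : hom x p) (dg : hom y p) (s : span x y) :
  is_product p -> sfst p ∘ fg = f -> ssnd p ∘ fg = g ->
  sfst p ∘ dg = idm y -> ssnd p ∘ dg = idm y ->
  is_pullback fg dg s -> is_equalizer f g (sfst s).
Proof.
move=> pp f1 g1 d1 d2 [sc su].
have fe : f ∘ sfst s = ssnd s by rewrite -f1 -compA sc compA d1 comp_idl.
have ge : g ∘ sfst s = ssnd s by rewrite -g1 -compA sc compA d2 comp_idl.
split; first by rewrite fe ge.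
move=> w a fga.
have [|u [[u1 u2] uu]] := su w a (f ∘ a).
  have [v [_ vu]] := pp w (f ∘ a) (g ∘ a).
  rewrite -(vu (fg ∘ a)); last by rewrite !compA f1 g1.
  by rewrite -(vu (dg ∘ (f ∘ a))) // !compA d1 d2 !comp_idl.
exists u; split=> // v va; apply: uu; split=> //.
by rewrite -fe -compA va.
Qed.

Lemma fp_equalizer (x y : C) (f g : hom x y) :
  exists k (e : hom k x), is_equalizer f g e /\
    is_equalizer (fmap F f) (fmap F g) (fmap F e).
Proof.
have [p [pp Fp]] := fp_product y y.
have [fg [[f1 g1] _]] := pp _ f g.
have [dg [[d1 d2] _]] := pp _ (idm y) (idm y).
have [s [ps Fs]] := FP fg dg.
exists s, (sfst s); split; first exact: equalizer_of_pullback ps.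
by apply: (equalizer_of_pullback Fp _ _ _ _ Fs);
  rewrite /= -fmap_comp ?f1 ?g1 ?d1 ?d2 ?fmap_id.
Qed.

Definition is_list_product (K : category) (I : Type) (D : I -> K) (s : seq I) (x : K)
    (p : forall i, List.In i s -> hom x (D i)) :=
  forall w (q : forall i, List.In i s -> hom w (D i)),
  exists! u : hom w x, forall i h, p i h ∘ u = q i h.

Definition cons_legs (K : category) (I : Type) (D : I -> K) (a : I) (s : seq I)
    (y : K) (p : forall i, List.In i s -> hom y (D i)) (t : span (D a) y)
    (i : I) (h : List.In i (a :: s)) : hom t (D i) :=
  match pselect (a = i) with
  | left e => ecast i (hom t (D i)) e (sfst t)
  | right n => p i (match h with or_introl e => False_ind _ (n e)
                    | or_intror h => h end) ∘ ssnd t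
  end.

Lemma is_list_product_cons (K : category) (I : Type) (D : I -> K) a s (y : K)
    (p : forall i, List.In i s -> hom y (D i)) (t : span (D a) y) :
  ~ List.In a s -> is_list_product p -> is_product t ->
  is_list_product (cons_legs p t).
Proof.
move=> as_ pp tp w q.
have [v [vq vu]] := pp w (fun i h => q i (or_intror h)).
have [u [[u1 u2] uu]] := tp w (q a (or_introl erefl)) v.
exists u; split=> [i h|u' u'q].
  rewrite /cons_legs; case: pselect => [e|n].
    by destruct e => /=; rewrite u1; congr q; apply: Prop_irrelevance.
  by rewrite -compA u2 vq; congr q; apply: Prop_irrelevance.
apply: uu; split.
  have := u'q a (or_introl erefl); rewrite /cons_legs; case: pselect => // e.
  by rewrite (Prop_irrelevance e erefl).
apply/esym/vu => i h; have := u'q i (or_intror h); rewrite /cons_legs.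
by case: pselect => [e|n]; [case: as_; rewrite e | rewrite compA].
Qed.

Lemma fp_list_product (I : Type) (D : I -> C) (s : seq I) :
  exists x (p : forall i, List.In i s -> hom x (D i)), is_list_product p /\
    is_list_product (D := fun i => F (D i)) (fun i h => fmap F (p i h)).
Proof.
elim: s => [|a s [y [p [pp Fp]]]].
  have [t [tt Ft]] := FT; exists t, (fun i (h : List.In i [::]) => False_rect _ h).
  split=> w q; first by have [u [_ uu]] := tt w; exists u; split=> // v _; apply: uu.
  by have [u [_ uu]] := Ft w; exists u; split=> // v _; apply: uu.
have [as_|as_] := pselect (List.In a s).
  have sub i : List.In i (a :: s) -> List.In i s by move=> [<-|].
  exists y, (fun i h => p i (sub i h)); split=> w q.
    have [u [uq uu]] := pp w (fun i h => q i (or_intror h)).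
    exists u; split=> [i h|v vq]; first by rewrite uq; congr q; apply: Prop_irrelevance.
    by apply: uu => i h; rewrite -vq; congr (p _ _ ∘ _); apply: Prop_irrelevance.
  have [u [uq uu]] := Fp w (fun i h => q i (or_intror h)).
  exists u; split=> [i h|v vq]; first by rewrite uq; congr q; apply: Prop_irrelevance.
  by apply: uu => i h; rewrite -vq; congr (fmap F (p _ _) ∘ _); apply: Prop_irrelevance.
have [t [tp Ft]] := fp_product (D a) y.
exists t, (cons_legs p t); split; first exact: is_list_product_cons.
have := is_list_product_cons as_ Fp Ft.
congr is_list_product; apply: functional_extensionality_dep => i.
apply: functional_extensionality_dep => h.
rewrite /cons_legs; case: pselect => [e|n]; first by destruct e.
by rewrite fmap_comp.
Qed.

Section Diagram.
Variables (J : category) (finJ : finite_category J).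
Record arrow := Arrow { src : J; tgt : J; arr : hom src tgt }.

Lemma finite_arrows : exists l : seq arrow, forall a, List.In a l.
Proof.
have [js jsP] := finite_set_list (proj1 finJ).
pose hs i j := sval (cid (finite_set_list (proj2 finJ i j))).
exists (List.flat_map (fun i => List.flat_map (fun j =>
  List.map (@Arrow i j) (hs i j)) js) js) => -[i j u].
apply/List.in_flat_map; exists i; split=> //.
apply/List.in_flat_map; exists j; split=> //.
by apply/List.in_map; rewrite /hs; case: cid.
Qed.

Definition commutes (K : category) (D : functor J K) (l : seq arrow) (x : K)
    (p : forall j, hom x (D j)) :=
  forall a, List.In a l -> fmap D (arr a) ∘ p (src a) = p (tgt a).

Definition is_partial_limit (K : category) (D : functor J K) (l : seq arrow)
    (x : K) (p : forall j, hom x (D j)) :=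
  commutes l p /\ forall w (q : forall j, hom w (D j)), commutes l q ->
  exists! u : hom w x, forall j, p j ∘ u = q j.

Lemma is_partial_limit_cons (K : category) (D : functor J K) l (x : K)
    (p : forall j, hom x (D j)) a k (e : hom k x) :
  is_partial_limit l p -> is_equalizer (fmap D (arr a) ∘ p (src a)) (p (tgt a)) e ->
  is_partial_limit (a :: l) (fun j => p j ∘ e).
Proof.
move=> [cp pp] [ee eu]; split=> [b [<-|bl]|w q cq].
- by rewrite compA.
- by rewrite compA cp.
have [|u [uq uu]] := pp w q; first by move=> b bl; apply: cq; right.
have [|v [vu vv]] := eu w u; first by rewrite -compA !uq; apply: cq; left.
exists v; split=> [j|v' v'q]; first by rewrite -compA vu uq.
by apply: vv; apply/esym/uu => j; rewrite compA.
Qed.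

Lemma fp_partial_limit (D : functor J C) (l : seq arrow) :
  exists x (p : forall j, hom x (D j)), is_partial_limit l p /\
    is_partial_limit (D := functor_comp F D) l (fun j => fmap F (p j)).
Proof.
elim: l => [|a l [x [p [pp Fp]]]].
  have [js jsP] := finite_set_list (proj1 finJ).
  have [x [p [pp Fp]]] := fp_list_product D js.
  exists x, (fun j => p j (jsP j)); split; split=> // w q _.
    have [u [uq uu]] := pp w (fun j _ => q j).
    exists u; split=> [j|v vq]; first exact: (uq j (jsP j)).
    by apply: uu => j h; rewrite (Prop_irrelevance h (jsP j)); apply: vq.
  have [u [uq uu]] := Fp w (fun j _ => q j).
    exists u; split=> [j|v vq]; first exact: (uq j (jsP j)).
  by apply: uu => j h; rewrite (Prop_irrelevance h (jsP j)); apply: vq.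
have [k [e [ee Fe]]] := fp_equalizer (fmap D (arr a) ∘ p (src a)) (p (tgt a)).
exists k, (fun j => p j ∘ e); split; first exact: is_partial_limit_cons.
have -> : (fun j => fmap F (p j ∘ e)) = (fun j => fmap F (p j) ∘ fmap F e).
  by apply: functional_extensionality_dep => j; rewrite fmap_comp.
by apply: (is_partial_limit_cons Fp); rewrite /= -fmap_comp.
Qed.

Lemma fp_limit (D : functor J C) :
  exists L : cone D, is_limit L /\ is_limit (fmap_cone F L).
Proof.
have [l lP] := finite_arrows; have [x [p [[cp pp] [_ Fp]]]] := fp_partial_limit D l.
exists (@Cone _ _ _ x p (fun i j u => cp (Arrow u) (lP _))).
by split=> -[w q qE]; [apply: pp | apply: Fp] => a _; apply: qE.
Qed.
End Diagram.
End FiniteLimitsFromPullbacks.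

Lemma is_limit_preserved (C E : category) (F : functor C E) (J : category)
    (D : functor J C) (L K : cone D) :
  is_limit L -> is_limit (fmap_cone F L) -> is_limit K -> is_limit (fmap_cone F K).
Proof.
move=> lL FL lK M.
have [u [uL uu]] := lK L; have [v [vK vu]] := lL K.
have vu1 : u ∘ v = idm _.
  have [i [_ iu]] := lK K.
  rewrite -(iu (idm _)) ?(iu (u ∘ v)) // => j; rewrite ?comp_idr //.
  by rewrite compA uL vK.
have [w [wM wu]] := FL M.
exists (fmap F u ∘ w); split=> [j|w' w'M].
  by rewrite compA -fmap_comp uL; apply: wM.
rewrite (wu (fmap F v ∘ w')); first by rewrite compA -fmap_comp vu1 fmap_id comp_idl.
by move=> j; rewrite compA -fmap_comp vK; apply: w'M.
Qed.

Lemma finite_limits_of_pullbacks (C : category) :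
  (exists t : C, is_terminal t) ->
  (forall (x y z : C) (f : hom x z) (g : hom y z), exists s, is_pullback f g s) ->
  has_finite_limits C.
Proof.
move=> [t tt] pb J finJ D.
have [|x y z f g|L [lL _]] := fp_limit (F := functor_id C) _ _ finJ D.
- by exists t.
- by have [s ps] := pb _ _ _ f g; exists s.
by exists L.
Qed.

Lemma preserves_of_pullbacks (C E : category) (F : functor C E) :
  (exists t : C, is_terminal t /\ is_terminal (F t)) ->
  (forall (x y z : C) (f : hom x z) (g : hom y z), exists s,
    is_pullback f g s /\ is_pullback (fmap F f) (fmap F g) (fmap_span F s)) ->
  preserves_finite_limits F.
Proof.
move=> FT FP J finJ D L lL.
by have [K [lK FK]] := fp_limit FT FP finJ D; apply: is_limit_preserved FK lL.
Qed.

Definition empty_category : category :=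
  @Category void (fun _ _ => void) (fun x => x) (fun _ _ _ _ f => f)
    (fun _ _ f => match f with end) (fun _ _ f => match f with end)
    (fun _ _ _ _ _ _ f => match f with end).

Lemma finite_empty_category : finite_category empty_category.
Proof. by split=> [|[]]; apply: (@finite_finset void). Qed.

Definition empty_diagram (C : category) : functor empty_category C :=
  @Functor empty_category C (fun v => match v with end)
    (fun v _ _ => match v with end) (fun v => match v with end)
    (fun v _ _ _ _ => match v with end).

Definition empty_cone (C : category) (t : C) : cone (empty_diagram C) :=
  @Cone _ _ (empty_diagram C) t (fun v => match v with end)
    (fun v => match v with end).

(* The shape of a pullback: the poset with [None] above [Some true] and
   [Some false]. *)
Definition cospan_rel (i j : option bool) : bool := (i == j) || (j == None).

Lemma cospan_refl i : cospan_rel i i. Proof. by rewrite /cospan_rel eqxx. Qed.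
Lemma cospan_trans i j k : cospan_rel j k -> cospan_rel i j -> cospan_rel i k.
Proof. by case: i j k => [[]|] [[]|] [[]|]. Qed.

Definition cospan_category : category :=
  @Category (option bool) (fun i j => cospan_rel i j) cospan_refl
    (fun i j k => @cospan_trans i j k)
    (fun _ _ _ => Prop_irrelevance _ _) (fun _ _ _ => Prop_irrelevance _ _)
    (fun _ _ _ _ _ _ _ => Prop_irrelevance _ _).

Lemma finite_cospan_category : finite_category cospan_category.
Proof.
split=> [|i j]; first exact: (@finite_finset (option bool)).
have [h|nh] := boolP (cospan_rel i j).
  by apply: sub_finite_set (finite_set1 h) => h' _; apply: Prop_irrelevance.
by apply: sub_finite_set (finite_set0 _) => h' _; have := h'; rewrite /hom /= (negbTE nh).
Qed.

Section CospanDiagram.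
Variables (C : category) (x y z : C) (f : hom x z) (g : hom y z).

Definition cospan_obj (i : option bool) : C :=
  match i with Some true => x | Some false => y | None => z end.

Definition cospan_map (i j : option bool) :
    cospan_rel i j -> hom (cospan_obj i) (cospan_obj j) :=
  match i, j return cospan_rel i j -> hom (cospan_obj i) (cospan_obj j) with
  | Some true, Some true => fun _ => idm x
  | Some false, Some false => fun _ => idm y
  | None, None => fun _ => idm z
  | Some true, None => fun _ => f
  | Some false, None => fun _ => g
  | Some true, Some false | Some false, Some true
  | None, Some true | None, Some false => fun h => False_rect _ (notF h)
  end.

Lemma cospan_map_id i (h : cospan_rel i i) : cospan_map h = idm (cospan_obj i).
Proof. by case: i h => [[]|]. Qed.
Lemma cospan_map_comp i j k (v : cospan_rel j k) (u : cospan_rel i j) :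
  cospan_map (cospan_trans v u) = cospan_map v ∘ cospan_map u.
Proof.
by case: i j k v u => [[]|] [[]|] [[]|] v u //=; rewrite ?comp_idl ?comp_idr.
Qed.

Definition cospan_diagram : functor cospan_category C :=
  @Functor cospan_category C cospan_obj (fun i j u => @cospan_map i j u)
    (fun i => cospan_map_id _) (fun i j k v u => cospan_map_comp v u).

Definition cospan_leg (s : span x y) (i : option bool) : hom s (cospan_obj i) :=
  match i with
  | Some true => sfst s | Some false => ssnd s | None => f ∘ sfst s
  end.

Lemma cospan_legE (s : span x y) (e : f ∘ sfst s = g ∘ ssnd s) i j
    (u : cospan_rel i j) : cospan_map u ∘ cospan_leg s i = cospan_leg s j.
Proof. by case: i j u => [[]|] [[]|] u //=; rewrite ?comp_idl. Qed.

Definition cospan_cone (s : span x y) (e : f ∘ sfst s = g ∘ ssnd s) :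
  cone cospan_diagram := @Cone _ _ cospan_diagram s (cospan_leg s) (cospan_legE e).

Lemma cospan_cone_limit (s : span x y) (e : f ∘ sfst s = g ∘ ssnd s) :
  is_pullback f g s -> is_limit (cospan_cone e).
Proof.
move=> [_ sp] [w q qE].
have [|u [[u1 u2] uu]] := sp w (q (Some true)) (q (Some false)).
  by rewrite (qE (Some true) None isT) (qE (Some false) None isT).
exists u; split=> [[[]|]|v vq] //=; first by rewrite -compA u1 (qE (Some true) None isT).
by apply: uu; split; [exact: (vq (Some true)) | exact: (vq (Some false))].
Qed.

End CospanDiagram.

Section PullbackOfLimit.
Variables (C E : category) (F : functor C E).
Variables (x y z : C) (f : hom x z) (g : hom y z).

Lemma pullback_of_limit (L : cone (cospan_diagram f g)) :
  is_limit (fmap_cone F L) ->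
  is_pullback (fmap F f) (fmap F g)
    (fmap_span F (Span (leg L (Some true)) (leg L (Some false)))).
Proof.
have e1 := legE L (isT : @hom cospan_category (Some true) None).
have e2 := legE L (isT : @hom cospan_category (Some false) None).
rewrite /= in e1 e2 => lL; split=> [|w a b e].
  by rewrite /= -!fmap_comp e1 e2.
pose q (i : option bool) : hom w (F (cospan_obj x y z i)) :=
  match i with Some true => a | Some false => b | None => fmap F f ∘ a end.
have qE i j (u : cospan_rel i j) : fmap F (cospan_map f g u) ∘ q i = q j.
  by case: i j u => [[]|] [[]|] u //=; rewrite ?fmap_id ?comp_idl.
have [u [uq uu]] := lL (@Cone _ _ (functor_comp F (cospan_diagram f g)) w q qE).
exists u; split; first by split; [exact: (uq (Some true)) | exact: (uq (Some false))].
move=> v [/= v1 v2]; apply: uu => -[[]|] //=.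
by rewrite -e1 fmap_comp -compA v1.
Qed.
End PullbackOfLimit.

Lemma lex_terminal (C : category) : has_finite_limits C -> exists t : C, is_terminal t.
Proof.
move=> lC; have [L lL] := lC _ finite_empty_category (empty_diagram C).
exists (apex L) => x; have [u [_ uu]] := lL (empty_cone x).
by exists u; split=> // v _; apply: uu => -[].
Qed.

Lemma lex_pullback (C : category) : has_finite_limits C ->
  forall (x y z : C) (f : hom x z) (g : hom y z), exists s, is_pullback f g s.
Proof.
move=> lC x y z f g.
have [L lL] := lC _ finite_cospan_category (cospan_diagram f g).
exists (Span (leg L (Some true)) (leg L (Some false))).
apply: (pullback_of_limit (F := functor_id C) (L := L)) => -[w q qE].
exact: (lL (@Cone _ _ (cospan_diagram f g) w q qE)).
Qed.

Lemma lex_product (C : category) : has_finite_limits C ->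
  forall (x y : C), exists s : span x y, is_product s.
Proof.
move=> lC x y; have [t tt] := lex_terminal lC.
have [|X Y Z f g|s [ps _]] := fp_product (F := functor_id C) _ _ x y.
- by exists t.
- by have [s ps] := lex_pullback lC f g; exists s.
by exists s.
Qed.

Section Preservation.
Variables (C E : category) (F : functor C E).
Hypotheses (lC : has_finite_limits C) (lF : preserves_finite_limits F).

Lemma preserves_terminal (t : C) : is_terminal t -> is_terminal (F t).
Proof.
move=> tt x; have lt : is_limit (empty_cone t).
  by move=> K; have [u [_ uu]] := tt (apex K); exists u; split=> [[]|v _]; apply: uu.
have [u [_ uu]] := lF finite_empty_category lt
  (@Cone _ _ (functor_comp F (empty_diagram C)) x
     (fun v : void => match v with end) (fun v => match v with end)).
by exists u; split=> // v _; apply: uu => -[].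
Qed.

Lemma preserves_pullback (x y z : C) (f : hom x z) (g : hom y z) s :
  is_pullback f g s -> is_pullback (fmap F f) (fmap F g) (fmap_span F s).
Proof.
move=> ps; have e := proj1 ps.
have := pullback_of_limit (lF finite_cospan_category (cospan_cone_limit e ps)).
by case: s ps e.
Qed.

Lemma preserves_product (x y : C) (s : span x y) :
  is_product s -> is_product (fmap_span F s).
Proof.
have [t tt] := lex_terminal lC; have Ft := preserves_terminal tt.
have [a _] := tt x; have [b _] := tt y => ps.
have ab : a ∘ sfst s = b ∘ ssnd s.
  have [u [_ uu]] := tt s; by rewrite -(uu (a ∘ _) I) -(uu (b ∘ _) I).
have [_ Fs] : is_pullback (fmap F a) (fmap F b) (fmap_span F s).
  by apply: preserves_pullback; split=> // w c d _; apply: ps.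
move=> w c d; apply: Fs.
by have [u [_ uu]] := Ft w; rewrite -(uu (fmap F a ∘ c) I) -(uu (fmap F b ∘ d) I).
Qed.

Lemma preserves_monic (x y : C) (m : hom x y) : monic m -> monic (fmap F m).
Proof.
move=> mm; have [_ Fs] : is_pullback (fmap F m) (fmap F m)
    (fmap_span F (Span (idm x) (idm x))).
  apply: preserves_pullback; split=> // w a b /mm ->.
  by exists b; split; rewrite /= ?comp_idl // => v []; rewrite !comp_idl.
move=> w u v muv; have [k [[]]] := Fs w u v muv.
by rewrite /= fmap_id !comp_idl => -> ->.
Qed.
End Preservation.

Record bicategory := Bicategory {
  cell0 :> Type;
  cell1 : cell0 -> cell0 -> Type;
  cell2 : forall x y, cell1 x y -> cell1 x y -> Type;
  id1 : forall x, cell1 x x;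
  comp1 : forall x y z, cell1 y z -> cell1 x y -> cell1 x z;
  id2 : forall x y (f : cell1 x y), cell2 f f;
  comp2 : forall x y (f g h : cell1 x y), cell2 g h -> cell2 f g -> cell2 f h;
  lwhisker : forall x y z (g : cell1 y z) (f f' : cell1 x y),
    cell2 f f' -> cell2 (comp1 g f) (comp1 g f');
  rwhisker : forall x y z (g g' : cell1 y z),
    cell2 g g' -> forall f : cell1 x y, cell2 (comp1 g f) (comp1 g' f);
  lunitor : forall x y (f : cell1 x y), cell2 (comp1 (id1 y) f) f;
  lunitorV : forall x y (f : cell1 x y), cell2 f (comp1 (id1 y) f);
  runitor : forall x y (f : cell1 x y), cell2 (comp1 f (id1 x)) f;
  runitorV : forall x y (f : cell1 x y), cell2 f (comp1 f (id1 x));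
  assoc : forall w x y z (h : cell1 y z) (g : cell1 x y) (f : cell1 w x),
    cell2 (comp1 h (comp1 g f)) (comp1 (comp1 h g) f);
  assocV : forall w x y z (h : cell1 y z) (g : cell1 x y) (f : cell1 w x),
    cell2 (comp1 (comp1 h g) f) (comp1 h (comp1 g f));

  comp2_idl : forall x y (f g : cell1 x y) (a : cell2 f g), comp2 (id2 g) a = a;
  comp2_idr : forall x y (f g : cell1 x y) (a : cell2 f g), comp2 a (id2 f) = a;
  comp2A : forall x y (f g h k : cell1 x y)
      (c : cell2 h k) (b : cell2 g h) (a : cell2 f g),
    comp2 c (comp2 b a) = comp2 (comp2 c b) a;
  lwhisker_id : forall x y z (g : cell1 y z) (f : cell1 x y),
    lwhisker g (id2 f) = id2 (comp1 g f);
  lwhisker_comp : forall x y z (g : cell1 y z) (f f' f'' : cell1 x y)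
      (b : cell2 f' f'') (a : cell2 f f'),
    lwhisker g (comp2 b a) = comp2 (lwhisker g b) (lwhisker g a);
  rwhisker_id : forall x y z (g : cell1 y z) (f : cell1 x y),
    rwhisker (id2 g) f = id2 (comp1 g f);
  rwhisker_comp : forall x y z (g g' g'' : cell1 y z) (f : cell1 x y)
      (b : cell2 g' g'') (a : cell2 g g'),
    rwhisker (comp2 b a) f = comp2 (rwhisker b f) (rwhisker a f);
  interchange : forall x y z (g g' : cell1 y z) (f f' : cell1 x y)
      (b : cell2 g g') (a : cell2 f f'),
    comp2 (rwhisker b f') (lwhisker g a) = comp2 (lwhisker g' a) (rwhisker b f);
  lunitorK : forall x y (f : cell1 x y), comp2 (lunitorV f) (lunitor f) = id2 _;
  lunitorVK : forall x y (f : cell1 x y), comp2 (lunitor f) (lunitorV f) = id2 _;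
  runitorK : forall x y (f : cell1 x y), comp2 (runitorV f) (runitor f) = id2 _;
  runitorVK : forall x y (f : cell1 x y), comp2 (runitor f) (runitorV f) = id2 _;
  assocK : forall w x y z (h : cell1 y z) (g : cell1 x y) (f : cell1 w x),
    comp2 (assocV h g f) (assoc h g f) = id2 _;
  assocVK : forall w x y z (h : cell1 y z) (g : cell1 x y) (f : cell1 w x),
    comp2 (assoc h g f) (assocV h g f) = id2 _;
  lunitor_nat : forall x y (f g : cell1 x y) (a : cell2 f g),
    comp2 (lunitor g) (lwhisker (id1 y) a) = comp2 a (lunitor f);
  runitor_nat : forall x y (f g : cell1 x y) (a : cell2 f g),
    comp2 (runitor g) (rwhisker a (id1 x)) = comp2 a (runitor f);
  assoc_natl : forall w x y z (h h' : cell1 y z) (g : cell1 x y) (f : cell1 w x)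
      (c : cell2 h h'),
    comp2 (assoc h' g f) (rwhisker c (comp1 g f)) =
    comp2 (rwhisker (rwhisker c g) f) (assoc h g f);
  assoc_natm : forall w x y z (h : cell1 y z) (g g' : cell1 x y) (f : cell1 w x)
      (b : cell2 g g'),
    comp2 (assoc h g' f) (lwhisker h (rwhisker b f)) =
    comp2 (rwhisker (lwhisker h b) f) (assoc h g f);
  assoc_natr : forall w x y z (h : cell1 y z) (g : cell1 x y) (f f' : cell1 w x)
      (a : cell2 f f'),
    comp2 (assoc h g f') (lwhisker h (lwhisker g a)) =
    comp2 (lwhisker (comp1 h g) a) (assoc h g f);
  pentagon : forall v w x y z (k : cell1 y z) (h : cell1 x y) (g : cell1 w x)
      (f : cell1 v w),
    comp2 (assoc (comp1 k h) g f) (assoc k h (comp1 g f)) =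
    comp2 (rwhisker (assoc k h g) f)
      (comp2 (assoc k (comp1 h g) f) (lwhisker k (assoc h g f)));
  triangle : forall x y z (g : cell1 y z) (f : cell1 x y),
    comp2 (rwhisker (runitor g) f) (assoc g (id1 y) f) = lwhisker g (lunitor f) }.

Arguments cell1 {b} x y : rename.
Arguments cell2 {b x y} f g : rename.
Arguments id1 {b} x : rename.
Arguments comp1 {b x y z} g f : rename.
Arguments id2 {b x y} f : rename.
Arguments comp2 {b x y f g h} c a : rename.
Arguments lwhisker {b x y z} g {f f'} a : rename.
Arguments rwhisker {b x y z g g'} a f : rename.
Arguments lunitor {b x y} f : rename.
Arguments lunitorV {b x y} f : rename.
Arguments runitor {b x y} f : rename.
Arguments runitorV {b x y} f : rename.
Arguments assoc {b w x y z} h g f : rename.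
Arguments assocV {b w x y z} h g f : rename.

Declare Scope bicat_scope.
Delimit Scope bicat_scope with bicat.
Notation "f ⇒ g" := (cell2 f g) (at level 70, no associativity) : bicat_scope.
Notation "g ⊙ f" := (comp1 g f) (at level 40, left associativity) : bicat_scope.
Notation "b • a" := (comp2 b a) (at level 50, left associativity) : bicat_scope.
Notation "g ◁ a" := (lwhisker g a) (at level 45, no associativity) : bicat_scope.
Notation "b ▷ f" := (rwhisker b f) (at level 45, no associativity) : bicat_scope.

Section KZ.
Local Open Scope bicat_scope.
Variable B : bicategory.

Definition invertible (x y : B) (f g : cell1 x y) (a : f ⇒ g) :=
  exists b : g ⇒ f, b • a = id2 f /\ a • b = id2 g.

(* A left Kan extension of [f] along [p]; [lan_desc t] is the unique 2-cell
   through which [t] factors. *)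
Record lan (x y z : B) (p : cell1 x y) (f : cell1 x z) := Lan {
  lan_mor :> cell1 y z;
  lan_cell : f ⇒ lan_mor ⊙ p;
  lan_desc : forall g : cell1 y z, f ⇒ g ⊙ p -> lan_mor ⇒ g;
  lan_fac : forall (g : cell1 y z) (t : f ⇒ g ⊙ p), (lan_desc t ▷ p) • lan_cell = t;
  lan_uniq : forall (g : cell1 y z) (t : f ⇒ g ⊙ p) (a : lan_mor ⇒ g),
    (a ▷ p) • lan_cell = t -> a = lan_desc t }.

Section Comparison.
Variables (P : B -> B) (i : forall x, cell1 x (P x)).

Definition lan_id_cell (x : B) (L : lan (i x) (i x ⊙ id1 x)) : lan_mor L ⇒ id1 (P x) :=
  lan_desc L (lunitorV (i x) • runitor (i x)).

Definition lan_comp_cell (x y z : B) (g : cell1 y z) (f : cell1 x y)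
    (Lgf : lan (i x) (i z ⊙ (g ⊙ f))) (Lg : lan (i y) (i z ⊙ g))
    (Lf : lan (i x) (i y ⊙ f)) : lan_mor Lgf ⇒ lan_mor Lg ⊙ lan_mor Lf :=
  lan_desc Lgf (assoc Lg Lf (i x) • (lan_mor Lg ◁ lan_cell Lf) • assocV Lg (i y) f
                • (lan_cell Lg ▷ f) • assoc (i z) g f).

Definition lan_precomp_cell (x x' y : B) (f : cell1 x y) (g : cell1 x' x)
    (Lfg : lan (i x') (f ⊙ g)) (Lf : lan (i x) f) (Lg : lan (i x') (i x ⊙ g)) :
    lan_mor Lfg ⇒ lan_mor Lf ⊙ lan_mor Lg :=
  lan_desc Lfg (assoc Lf Lg (i x') • (lan_mor Lf ◁ lan_cell Lg) • assocV Lf (i x) g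
                • (lan_cell Lf ▷ g)).

Definition lan_postcomp_cell (x y : B) (f : cell1 x y)
    (Lf : lan (i x) f) (Lid : lan (i x) (id1 x)) : lan_mor Lf ⇒ f ⊙ lan_mor Lid :=
  lan_desc Lf (assoc f Lid (i x) • (f ◁ lan_cell Lid) • runitorV f).
End Comparison.

(* [kz_mor f] is the (chosen) Kan extension P(f); being a Kan extension it is
   determined by [kz_obj] and [kz_unit] up to a unique invertible 2-cell. *)
Record kz_machine := KZMachine {
  kz_obj :> B -> B;
  kz_unit : forall x, cell1 x (kz_obj x);
  kz_mor : forall x y (f : cell1 x y), lan (kz_unit x) (kz_unit y ⊙ f);
  kz_mor_inv : forall x y (f : cell1 x y), invertible (lan_cell (kz_mor f));
  kz_mor_comp : forall x y z (g : cell1 y z) (f : cell1 x y),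
    invertible (lan_comp_cell (kz_mor (g ⊙ f)) (kz_mor g) (kz_mor f));
  kz_mor_id : forall x, invertible (lan_id_cell (kz_mor (id1 x))) }.

Record kz_algebra (P : kz_machine) (y : B) := KZAlgebra {
  alg_ext : forall x (f : cell1 x y), lan (kz_unit P x) f;
  alg_ext_inv : forall x (f : cell1 x y), invertible (lan_cell (alg_ext f));
  alg_ext_comp : forall x x' (f : cell1 x y) (g : cell1 x' x),
    invertible (lan_precomp_cell (alg_ext (f ⊙ g)) (alg_ext f) (kz_mor P g)) }.

Definition cocomplete (P : kz_machine) (y : B) := inhabited (kz_algebra P y).

Definition alg_mul (P : kz_machine) (y : B) (Y : kz_algebra P y) :
  lan (kz_unit P y) (id1 y) := alg_ext Y (id1 y).

Definition linear (P : kz_machine) (x y : B) (X : kz_algebra P x)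
    (Y : kz_algebra P y) (f : cell1 x y) :=
  invertible (lan_postcomp_cell (alg_ext Y f) (alg_mul X)).

(* Kan extensions being unique up to a unique invertible 2-cell, linearity does
   not depend on the chosen algebra structures; all choices are quantified over. *)
Definition Morita_equivalent (P Q : kz_machine) :=
  (forall x : B, cocomplete P x <-> cocomplete Q x) /\
  (forall (x y : B) (X : kz_algebra P x) (Y : kz_algebra P y)
          (X' : kz_algebra Q x) (Y' : kz_algebra Q y) (f : cell1 x y),
     linear X Y f <-> linear X' Y' f).
End KZ.

(* Local smallness is a matter of universe levels: the objects and the homs of a
   [category] live in two fixed universes, of which the second may be smaller. *)
Record lex_category := LexCategory {
  lex_cat :> category;
  lex_catP : has_finite_limits lex_cat }.

Record lex_functor (C D : lex_category) := LexFunctor {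
  lex_fun :> functor C D;
  lex_funP : preserves_finite_limits lex_fun }.

Arguments lex_catP C : rename, clear implicits.
Arguments lex_funP {C D} F : rename.

Lemma functor_id_lex (C : category) : preserves_finite_limits (functor_id C).
Proof. by move=> J _ D L lL [w q qE]; apply: (lL (@Cone _ _ D w q qE)). Qed.

Lemma functor_comp_lex (C D E : category) (G : functor D E) (F : functor C D) :
  preserves_finite_limits G -> preserves_finite_limits F ->
  preserves_finite_limits (functor_comp G F).
Proof.
move=> lG lF J finJ K L lL [w q qE].
exact: (lG _ finJ _ _ (lF _ finJ _ _ lL)
  (@Cone _ _ (functor_comp G (functor_comp F K)) w q qE)).
Qed.

Definition lex_id (C : lex_category) : lex_functor C C :=
  LexFunctor (@functor_id_lex C).

Definition lex_comp (C D E : lex_category) (G : lex_functor D E) (F : lex_functor C D) :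
  lex_functor C E := LexFunctor (functor_comp_lex (lex_funP G) (lex_funP F)).

Section NatTransOps.
Variables (C D : category).
Lemma nat_id_proof (F : functor C D) x y (f : hom x y) :
  idm (F y) ∘ fmap F f = fmap F f ∘ idm (F x).
Proof. by rewrite comp_idl comp_idr. Qed.
Definition nat_id (F : functor C D) : nat_trans F F := NatTrans (nat_id_proof F).

Variables F G H : functor C D.
Lemma nat_comp_proof (b : nat_trans G H) (a : nat_trans F G) x y (f : hom x y) :
  (b y ∘ a y) ∘ fmap F f = fmap H f ∘ (b x ∘ a x).
Proof. by rewrite -compA ncompE compA ncompE compA. Qed.
Definition nat_comp (b : nat_trans G H) (a : nat_trans F G) : nat_trans F H :=
  NatTrans (nat_comp_proof b a).
End NatTransOps.

Section Whisker.
Variables (C D E : category).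
Lemma nat_lwhisker_proof (G : functor D E) (F F' : functor C D) (a : nat_trans F F')
  x y (f : hom x y) :
  fmap G (a y) ∘ fmap (functor_comp G F) f = fmap (functor_comp G F') f ∘ fmap G (a x).
Proof. by rewrite /= -!fmap_comp ncompE. Qed.
Definition nat_lwhisker (G : functor D E) (F F' : functor C D) (a : nat_trans F F') :
  nat_trans (functor_comp G F) (functor_comp G F') :=
  @NatTrans _ _ (functor_comp G F) (functor_comp G F') (fun x => fmap G (a x))
    (nat_lwhisker_proof G a).
Definition nat_rwhisker (G G' : functor D E) (b : nat_trans G G') (F : functor C D) :
  nat_trans (functor_comp G F) (functor_comp G' F) :=
  @NatTrans _ _ (functor_comp G F) (functor_comp G' F) (fun x => b (F x))
    (fun x y f => ncompE b (fmap F f)).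
End Whisker.

Section StructuralCells.
Variables (B C D E : category).
Variables (H : functor D E) (G : functor C D) (F : functor B C).
Definition nat_lunit : nat_trans (functor_comp (functor_id C) F) F :=
  @NatTrans _ _ (functor_comp (functor_id C) F) F
    (fun x => idm (F x)) (nat_id_proof F).
Definition nat_lunitV : nat_trans F (functor_comp (functor_id C) F) :=
  @NatTrans _ _ F (functor_comp (functor_id C) F)
    (fun x => idm (F x)) (nat_id_proof F).
Definition nat_runit : nat_trans (functor_comp F (functor_id B)) F :=
  @NatTrans _ _ (functor_comp F (functor_id B)) F
    (fun x => idm (F x)) (nat_id_proof F).
Definition nat_runitV : nat_trans F (functor_comp F (functor_id B)) :=
  @NatTrans _ _ F (functor_comp F (functor_id B))
    (fun x => idm (F x)) (nat_id_proof F).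
Definition nat_assoc : nat_trans (functor_comp H (functor_comp G F))
    (functor_comp (functor_comp H G) F) :=
  @NatTrans _ _ (functor_comp H (functor_comp G F)) (functor_comp (functor_comp H G) F)
    (fun x => idm (H (G (F x)))) (nat_id_proof (functor_comp H (functor_comp G F))).
Definition nat_assocV : nat_trans (functor_comp (functor_comp H G) F)
    (functor_comp H (functor_comp G F)) :=
  @NatTrans _ _ (functor_comp (functor_comp H G) F) (functor_comp H (functor_comp G F))
    (fun x => idm (H (G (F x)))) (nat_id_proof (functor_comp H (functor_comp G F))).
End StructuralCells.

Definition Lex : bicategory.
Proof.
refine (@Bicategory lex_category lex_functor (fun _ _ F G => nat_trans F G)
  lex_id lex_comp (fun _ _ F => nat_id F) (fun _ _ _ _ _ b a => nat_comp b a)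
  (fun _ _ _ G _ _ a => nat_lwhisker G a) (fun _ _ _ _ _ b F => nat_rwhisker b F)
  (fun _ _ F => nat_lunit F) (fun _ _ F => nat_lunitV F)
  (fun _ _ F => nat_runit F) (fun _ _ F => nat_runitV F)
  (fun _ _ _ _ H G F => nat_assoc H G F) (fun _ _ _ _ H G F => nat_assocV H G F)
  _ _ _ _ _ _ _ _ _ _ _ _ _ _ _ _ _ _ _ _ _) => *;
  abstract (apply: nat_trans_ext => ? /=;
    rewrite ?fmap_comp ?fmap_id ?compA ?comp_idl ?comp_idr ?ncompE //).
Defined.

Section ChosenLimits.
Variable C : lex_category.

Definition product (x y : C) : span x y := sval (cid (lex_product (lex_catP C) x y)).
Lemma productP (x y : C) : is_product (product x y).
Proof. by rewrite /product; case: cid. Qed.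

Definition pullback (x y z : C) (f : hom x z) (g : hom y z) : span x y :=
  sval (cid (lex_pullback (lex_catP C) f g)).
Lemma pullbackP (x y z : C) (f : hom x z) (g : hom y z) :
  is_pullback f g (pullback f g).
Proof. by rewrite /pullback; case: cid. Qed.

Lemma pairing_ex (w x y : C) (f : hom w x) (g : hom w y) :
  exists u : hom w (product x y), sfst _ ∘ u = f /\ ssnd _ ∘ u = g.
Proof. by have [u [uE _]] := productP f g; exists u. Qed.
Definition pairing (w x y : C) (f : hom w x) (g : hom w y) : hom w (product x y) :=
  sval (cid (pairing_ex f g)).
Lemma pairing_fst (w x y : C) (f : hom w x) (g : hom w y) : sfst _ ∘ pairing f g = f.
Proof. by rewrite /pairing; case: cid => u []. Qed.
Lemma pairing_snd (w x y : C) (f : hom w x) (g : hom w y) : ssnd _ ∘ pairing f g = g.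
Proof. by rewrite /pairing; case: cid => u []. Qed.

Lemma product_ext (w x y : C) (u v : hom w (product x y)) :
  sfst _ ∘ u = sfst _ ∘ v -> ssnd _ ∘ u = ssnd _ ∘ v -> u = v.
Proof.
move=> e1 e2; have [k [_ ku]] := productP (sfst _ ∘ v) (ssnd _ ∘ v).
by rewrite -(ku u) // -(ku v).
Qed.

Definition prod_hom (x y x' y' : C) (f : hom x x') (g : hom y y') :
  hom (product x y) (product x' y') := pairing (f ∘ sfst _) (g ∘ ssnd _).

Lemma pairing_comp (v w x y : C) (f : hom w x) (g : hom w y) (u : hom v w) :
  pairing f g ∘ u = pairing (f ∘ u) (g ∘ u).
Proof. by apply: product_ext; rewrite compA ?pairing_fst ?pairing_snd. Qed.

Lemma prod_hom_pairing (w x y x' y' : C) (f : hom x x') (g : hom y y')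
    (a : hom w x) (b : hom w y) :
  prod_hom f g ∘ pairing a b = pairing (f ∘ a) (g ∘ b).
Proof. by rewrite pairing_comp -!compA pairing_fst pairing_snd. Qed.

Lemma pairing_eq (w x y : C) (f f' : hom w x) (g g' : hom w y) :
  pairing f g = pairing f' g' <-> f = f' /\ g = g'.
Proof.
split=> [e|[-> ->] //].
by rewrite -(pairing_fst f g) -{2}(pairing_snd f g) e pairing_fst pairing_snd.
Qed.
End ChosenLimits.

Arguments pullback {C x y z} f g.
Arguments pairing {C w x y} f g.

Section EqvTwoGpd.
Variable C : lex_category.

(* [mul_ex] and [sym_ex] express that the associated 1-coskeletal simplicial object
   is Kan; the multiplication and the symmetry are not part of the structure, and
   no associativity, unit or inverse law is required of them. *)
Record eqv_2gpd := Eqv2Gpd {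
  ob0 : C;
  ob1 : C;
  d0 : hom ob1 ob0;
  d1 : hom ob1 ob0;
  sigma : hom ob0 ob1;
  d0_sigma : d0 ∘ sigma = idm ob0;
  d1_sigma : d1 ∘ sigma = idm ob0;
  mul_ex : exists c : hom (pullback d1 d0) ob1,
    d0 ∘ c = d0 ∘ sfst (pullback d1 d0) /\ d1 ∘ c = d1 ∘ ssnd (pullback d1 d0);
  sym_ex : exists t : hom ob1 ob1, d0 ∘ t = d1 /\ d1 ∘ t = d0 }.

(* No compatibility with [sigma] is required. *)
Record eqv_2gpd_hom (A B : eqv_2gpd) := Eqv2GpdHom {
  hom0 : hom (ob0 A) (ob0 B);
  hom1 : hom (ob1 A) (ob1 B);
  homE : pairing (d0 B) (d1 B) ∘ hom1 = prod_hom hom0 hom0 ∘ pairing (d0 A) (d1 A) }.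

Lemma eqv_2gpd_homE (A B : eqv_2gpd) (f0 : hom (ob0 A) (ob0 B)) (f1 : hom (ob1 A) (ob1 B)) :
  pairing (d0 B) (d1 B) ∘ f1 = prod_hom f0 f0 ∘ pairing (d0 A) (d1 A) <->
  d0 B ∘ f1 = f0 ∘ d0 A /\ d1 B ∘ f1 = f0 ∘ d1 A.
Proof. by rewrite prod_hom_pairing pairing_comp pairing_eq. Qed.

Lemma hom_d0 A B (f : eqv_2gpd_hom A B) : d0 B ∘ hom1 f = hom0 f ∘ d0 A.
Proof. by have /eqv_2gpd_homE [] := homE f. Qed.
Lemma hom_d1 A B (f : eqv_2gpd_hom A B) : d1 B ∘ hom1 f = hom0 f ∘ d1 A.
Proof. by have /eqv_2gpd_homE [] := homE f. Qed.

Definition mk_hom (A B : eqv_2gpd) (f0 : hom (ob0 A) (ob0 B)) (f1 : hom (ob1 A) (ob1 B))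
    (e0 : d0 B ∘ f1 = f0 ∘ d0 A) (e1 : d1 B ∘ f1 = f0 ∘ d1 A) : eqv_2gpd_hom A B :=
  Eqv2GpdHom (proj2 (eqv_2gpd_homE f0 f1) (conj e0 e1)).

Lemma eqv_2gpd_hom_ext A B (f g : eqv_2gpd_hom A B) :
  hom0 f = hom0 g -> hom1 f = hom1 g -> f = g.
Proof.
case: f g => f0 f1 fE [g0 g1 gE] /= e0 e1.
by subst; congr Eqv2GpdHom; apply: Prop_irrelevance.
Qed.

Lemma eqv_2gpd_id_proof A :
  pairing (d0 A) (d1 A) ∘ idm (ob1 A) =
  prod_hom (idm (ob0 A)) (idm (ob0 A)) ∘ pairing (d0 A) (d1 A).
Proof. by apply/eqv_2gpd_homE; rewrite !comp_idl !comp_idr. Qed.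
Definition eqv_2gpd_id A : eqv_2gpd_hom A A := Eqv2GpdHom (eqv_2gpd_id_proof A).

Lemma eqv_2gpd_comp_proof A B D (g : eqv_2gpd_hom B D) (f : eqv_2gpd_hom A B) :
  pairing (d0 D) (d1 D) ∘ (hom1 g ∘ hom1 f) =
  prod_hom (hom0 g ∘ hom0 f) (hom0 g ∘ hom0 f) ∘ pairing (d0 A) (d1 A).
Proof.
by apply/eqv_2gpd_homE; rewrite !compA !hom_d0 !hom_d1 -!compA !hom_d0 !hom_d1.
Qed.
Definition eqv_2gpd_comp A B D (g : eqv_2gpd_hom B D) (f : eqv_2gpd_hom A B) :
  eqv_2gpd_hom A D := Eqv2GpdHom (eqv_2gpd_comp_proof g f).

Lemma eqv_2gpd_idl A B (f : eqv_2gpd_hom A B) : eqv_2gpd_comp (eqv_2gpd_id B) f = f.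
Proof. by apply: eqv_2gpd_hom_ext; apply: comp_idl. Qed.
Lemma eqv_2gpd_idr A B (f : eqv_2gpd_hom A B) : eqv_2gpd_comp f (eqv_2gpd_id A) = f.
Proof. by apply: eqv_2gpd_hom_ext; apply: comp_idr. Qed.
Lemma eqv_2gpd_compA A B D E (h : eqv_2gpd_hom D E) (g : eqv_2gpd_hom B D)
    (f : eqv_2gpd_hom A B) :
  eqv_2gpd_comp h (eqv_2gpd_comp g f) = eqv_2gpd_comp (eqv_2gpd_comp h g) f.
Proof. by apply: eqv_2gpd_hom_ext; apply: compA. Qed.

Definition E2 : category := Category eqv_2gpd_idl eqv_2gpd_idr eqv_2gpd_compA.

Definition homotopic (A B : eqv_2gpd) (f g : eqv_2gpd_hom A B) :=
  exists h : hom (ob0 A) (ob1 B),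
    pairing (d0 B) (d1 B) ∘ h = pairing (hom0 f) (hom0 g).

Lemma homotopicE A B (f g : eqv_2gpd_hom A B) :
  homotopic f g <-> exists h, d0 B ∘ h = hom0 f /\ d1 B ∘ h = hom0 g.
Proof.
split=> -[h hE]; exists h; first by move: hE; rewrite pairing_comp pairing_eq.
by rewrite pairing_comp pairing_eq.
Qed.

(* The relation [A_1] on generalized elements of [A_0]. *)
Definition related (A : eqv_2gpd) (w : C) (x y : hom w (ob0 A)) :=
  exists h : hom w (ob1 A), d0 A ∘ h = x /\ d1 A ∘ h = y.

Lemma related_refl A w (x : hom w (ob0 A)) : related x x.
Proof. by exists (sigma A ∘ x); rewrite !compA d0_sigma d1_sigma !comp_idl. Qed.
Lemma related_sym A w (x y : hom w (ob0 A)) : related x y -> related y x.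
Proof.
move=> [h [<- <-]]; have [t [t0 t1]] := sym_ex A.
by exists (t ∘ h); rewrite !compA t0 t1.
Qed.
Lemma related_trans A w (x y z : hom w (ob0 A)) : related x y -> related y z -> related x z.
Proof.
move=> [h [<- hy]] [k [ky <-]]; have [c [c0 c1]] := mul_ex A.
have [_ pu] := pullbackP (d1 A) (d0 A).
have [|u [[u1 u2] _]] := pu w h k; first by rewrite hy ky.
by exists (c ∘ u); rewrite !compA c0 c1 -!compA u1 u2.
Qed.
Lemma related_comp A v w (x y : hom w (ob0 A)) (u : hom v w) :
  related x y -> related (x ∘ u) (y ∘ u).
Proof. by move=> [h [<- <-]]; exists (h ∘ u); rewrite !compA. Qed.
Lemma related_hom A B (f : eqv_2gpd_hom A B) w (x y : hom w (ob0 A)) :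
  related x y -> related (hom0 f ∘ x) (hom0 f ∘ y).
Proof. by move=> [h [<- <-]]; exists (hom1 f ∘ h); rewrite !compA hom_d0 hom_d1. Qed.

Lemma homotopicP A B (f g : eqv_2gpd_hom A B) :
  homotopic f g <-> related (hom0 f) (hom0 g).
Proof. exact: homotopicE. Qed.

Lemma homotopic_refl A B (f : eqv_2gpd_hom A B) : homotopic f f.
Proof. exact/homotopicP/related_refl. Qed.
Lemma homotopic_sym A B (f g : eqv_2gpd_hom A B) : homotopic f g -> homotopic g f.
Proof. by move=> /homotopicP fg; apply/homotopicP/related_sym. Qed.
Lemma homotopic_trans A B (f g h : eqv_2gpd_hom A B) :
  homotopic f g -> homotopic g h -> homotopic f h.
Proof.
by move=> /homotopicP fg /homotopicP gh; apply/homotopicP/(related_trans fg).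
Qed.
Lemma homotopic_comp A B D (g g' : eqv_2gpd_hom B D) (f f' : eqv_2gpd_hom A B) :
  homotopic g g' -> homotopic f f' ->
  homotopic (eqv_2gpd_comp g f) (eqv_2gpd_comp g' f').
Proof.
move=> /homotopicP gg /homotopicP ff; apply/homotopicP => /=.
by apply: related_trans (related_hom g ff) _; apply: related_comp.
Qed.

Definition Eh2_cat : category :=
  @quotient_category E2 homotopic homotopic_refl homotopic_sym homotopic_trans
    homotopic_comp.

Definition eqv_gpd (A : eqv_2gpd) := monic (pairing (d0 A) (d1 A)).

Definition Eh_cat : category := full_subcategory (C := Eh2_cat) eqv_gpd.
End EqvTwoGpd.

Section HomotopyClasses.
Variable C : lex_category.
Implicit Types A B D : eqv_2gpd C.

Definition hclass A B (f : eqv_2gpd_hom A B) : @hom (Eh2_cat C) A B :=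
  @quot_class (E2 C) (@homotopic C) A B f.

Definition hrepr A B (c : @hom (Eh2_cat C) A B) : eqv_2gpd_hom A B :=
  @quot_repr (E2 C) (@homotopic C) A B c.

Lemma hreprK A B (c : @hom (Eh2_cat C) A B) : hclass (hrepr c) = c.
Proof. exact: quot_reprK. Qed.

Lemma hclassP A B (f g : eqv_2gpd_hom A B) :
  hclass f = hclass g <-> related (hom0 f) (hom0 g).
Proof. by rewrite -homotopicP; apply: (@quot_classP (E2 C) (@homotopic C)
  (@homotopic_refl C) (@homotopic_sym C) (@homotopic_trans C)). Qed.

Lemma hclass_eq A B (f g : eqv_2gpd_hom A B) : hom0 f = hom0 g -> hclass f = hclass g.
Proof. by move=> e; apply/hclassP; rewrite e; apply: related_refl. Qed.

Lemma hclassE A B D (g : eqv_2gpd_hom B D) (f : eqv_2gpd_hom A B) :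
  hclass g ∘ hclass f = hclass (eqv_2gpd_comp g f).
Proof. exact: (@quot_compE (E2 C) (@homotopic C) (@homotopic_refl C)
  (@homotopic_sym C) (@homotopic_trans C) (@homotopic_comp C)). Qed.

Lemma hclass_id A : idm (A : Eh2_cat C) = hclass (eqv_2gpd_id A).
Proof. by []. Qed.

Lemma hclassW A B (c : @hom (Eh2_cat C) A B) : exists f, c = hclass f.
Proof. by exists (hrepr c); rewrite hreprK. Qed.

Lemma ex_hom A B (f0 : hom (ob0 A) (ob0 B)) :
  related (f0 ∘ d0 A) (f0 ∘ d1 A) -> exists f : eqv_2gpd_hom A B, hom0 f = f0.
Proof. by move=> [f1 [e0 e1]]; exists (mk_hom e0 e1). Qed.

Lemma related_d A : related (d0 A) (d1 A).
Proof. by exists (idm _); rewrite !comp_idr. Qed.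

Lemma hom_related A B (f : eqv_2gpd_hom A B) :
  related (hom0 f ∘ d0 A) (hom0 f ∘ d1 A).
Proof. exact/related_hom/related_d. Qed.

Lemma Eh2_terminal A : is_terminal (ob0 A) -> is_terminal (A : Eh2_cat C).
Proof.
move=> tA B; have [f0 [_ _]] := tA (ob0 B).
have eqA w (x y : hom w (ob0 A)) : x = y.
  by have [z [_ zu]] := tA w; rewrite -(zu x) // -(zu y).
have [|f _] := @ex_hom B A f0; first by rewrite (eqA _ (f0 ∘ d0 B) (f0 ∘ d1 B)); apply: related_refl.
exists (hclass f); split=> // g _; have [{}g ->] := hclassW g.
exact/hclass_eq/eqA.
Qed.

Lemma Eh2_pullback A B D P (f : eqv_2gpd_hom A D) (g : eqv_2gpd_hom B D)
    (p : eqv_2gpd_hom P A) (q : eqv_2gpd_hom P B) :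
  related (hom0 f ∘ hom0 p) (hom0 g ∘ hom0 q) ->
  (forall w (a : hom w (ob0 A)) (b : hom w (ob0 B)),
     related (hom0 f ∘ a) (hom0 g ∘ b) ->
     exists u : hom w (ob0 P), hom0 p ∘ u = a /\ hom0 q ∘ u = b) ->
  (forall w (s t : hom w (ob0 P)), related (hom0 p ∘ s) (hom0 p ∘ t) ->
     related (hom0 q ∘ s) (hom0 q ∘ t) -> related s t) ->
  is_pullback (hclass f) (hclass g)
    (Span (sapex := P : Eh2_cat C) (hclass p) (hclass q)).
Proof.
move=> fpgq P0 P1; split=> [|Z k l].
  by rewrite !hclassE; apply/hclassP.
have [{}k ->] := hclassW k; have [{}l ->] := hclassW l.
rewrite !hclassE => /hclassP kl; have [u0 [pu qu]] := P0 _ _ _ kl.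
have [|u uE] := @ex_hom Z P u0.
  by apply: P1; rewrite !compA ?pu ?qu; apply: hom_related.
subst u0; exists (hclass u); split.
  by rewrite /= !hclassE; split; apply: hclass_eq.
move=> v; have [{}v ->] := hclassW v; rewrite /= !hclassE => -[/hclassP pv /hclassP qv].
apply/hclassP/P1; rewrite ?pu ?qu; exact: related_sym.
Qed.
End HomotopyClasses.

Section MakeTwoGpd.
Variables (C : lex_category) (x r : C) (s t : hom r x).
Hypothesis r_refl : exists g : hom x r, s ∘ g = idm x /\ t ∘ g = idm x.
Hypothesis r_sym : exists g : hom r r, s ∘ g = t /\ t ∘ g = s.
Hypothesis r_trans : forall w (a b : hom w r), t ∘ a = s ∘ b ->
  exists c : hom w r, s ∘ c = s ∘ a /\ t ∘ c = t ∘ b.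

Definition mk_2gpd : eqv_2gpd C :=
  @Eqv2Gpd C x r s t (sval (cid r_refl)) (proj1 (svalP (cid r_refl)))
    (proj2 (svalP (cid r_refl))) (r_trans (proj1 (pullbackP t s))) r_sym.
End MakeTwoGpd.

Section RestrictedRelation.
Variable K : category.

Definition is_restriction (x y z : K) (s t : hom y z) (p : hom x z) (r : K)
    (s' t' : hom r x) (a : hom r y) :=
  [/\ s ∘ a = p ∘ s', t ∘ a = p ∘ t' &
   forall w (u v : hom w x) (b : hom w y), s ∘ b = p ∘ u -> t ∘ b = p ∘ v ->
   exists! k : hom w r, [/\ s' ∘ k = u, t' ∘ k = v & a ∘ k = b]].

Lemma restriction_of_pullbacks (x y z : K) (s t : hom y z) (p : hom x z)
    (s1 : span x y) (s2 : span s1 x) :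
  is_pullback p s s1 -> is_pullback (t ∘ ssnd s1) p s2 ->
  is_restriction s t p (sfst s1 ∘ sfst s2) (ssnd s2) (ssnd s1 ∘ sfst s2).
Proof.
move=> [e1 u1] [e2 u2]; split; rewrite ?compA -?e1 ?e2 // => w u v b bu bv.
have [m [[mu mb] mm]] := u1 w u b (esym bu).
have [|k [[km kv] kk]] := u2 w m v; first by rewrite -compA mb.
exists k; split; first by split=> //; rewrite -compA km.
move=> k' [k1 k2 k3]; apply: kk; split=> //; apply/esym/mm.
by rewrite !compA.
Qed.

Definition is_two_restriction (x y z y' z' : K) (s t : hom y z) (p : hom x z)
    (s' t' : hom y' z') (p' : hom x z') (r : K) (m n : hom r x)
    (a : hom r y) (a' : hom r y') :=
  [/\ s ∘ a = p ∘ m, t ∘ a = p ∘ n, s' ∘ a' = p' ∘ m, t' ∘ a' = p' ∘ n &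
   forall w (u v : hom w x) (b : hom w y) (b' : hom w y'),
   s ∘ b = p ∘ u -> t ∘ b = p ∘ v -> s' ∘ b' = p' ∘ u -> t' ∘ b' = p' ∘ v ->
   exists! k : hom w r, [/\ m ∘ k = u, n ∘ k = v, a ∘ k = b & a' ∘ k = b']].

Lemma two_restriction_of_restrictions (x y z y' z' : K) (s t : hom y z)
    (p : hom x z) (s' t' : hom y' z') (p' : hom x z') (r r' : K) (m n : hom r x)
    (a : hom r y) (m' n' : hom r' x) (a' : hom r' y') (xx : span x x)
    (j : hom r xx) (j' : hom r' xx) (q : span r r') :
  is_restriction s t p m n a -> is_restriction s' t' p' m' n' a' ->
  is_product xx -> sfst xx ∘ j = m -> ssnd xx ∘ j = n ->
  sfst xx ∘ j' = m' -> ssnd xx ∘ j' = n' -> is_pullback j j' q ->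
  is_two_restriction s t p s' t' p' (m ∘ sfst q) (n ∘ sfst q) (a ∘ sfst q) (a' ∘ ssnd q).
Proof.
move=> [e1 e2 U] [e1' e2' U'] xxP jm jn jm' jn' [eq_ Q].
have me : m ∘ sfst q = m' ∘ ssnd q by rewrite -jm -jm' -!compA eq_.
have ne : n ∘ sfst q = n' ∘ ssnd q by rewrite -jn -jn' -!compA eq_.
split.
- by rewrite !compA e1.
- by rewrite !compA e2.
- by rewrite me !compA e1'.
- by rewrite ne !compA e2'.
move=> w u v b b' bu bv b'u b'v.
have [k [[ku kv kb] kk]] := U _ _ _ _ bu bv.
have [k' [[k'u k'v k'b] kk']] := U' _ _ _ _ b'u b'v.
have [|l [[lk lk'] ll]] := Q w k k'.
  have [h [_ hh]] := xxP w u v.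
  transitivity h; first by apply/esym/hh; rewrite !compA jm jn.
  by apply/hh; rewrite !compA jm' jn'.
exists l; split; first by split; rewrite -compA ?lk ?lk'.
move=> l' [l1 l2 l3 l4]; apply: ll; split.
  by apply/esym/kk; rewrite !compA.
by apply/esym/kk'; rewrite !compA -me -ne.
Qed.
End RestrictedRelation.

Section Action.
Variables (C D : lex_category) (F : lex_functor C D).
Implicit Types A B : eqv_2gpd C.

Lemma act_d0_sigma A : fmap F (d0 A) ∘ fmap F (sigma A) = idm (F (ob0 A)).
Proof. by rewrite -fmap_comp d0_sigma fmap_id. Qed.
Lemma act_d1_sigma A : fmap F (d1 A) ∘ fmap F (sigma A) = idm (F (ob0 A)).
Proof. by rewrite -fmap_comp d1_sigma fmap_id. Qed.
Lemma act_mul_ex A :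
  let q := pullback (fmap F (d1 A)) (fmap F (d0 A)) in
  exists c : hom q (F (ob1 A)),
    fmap F (d0 A) ∘ c = fmap F (d0 A) ∘ sfst q /\
    fmap F (d1 A) ∘ c = fmap F (d1 A) ∘ ssnd q.
Proof.
move=> q; have [c [c0 c1]] := mul_ex A.
have [_ U] := preserves_pullback (lex_funP F) (pullbackP (d1 A) (d0 A)).
have [k [[/= k0 k1] _]] := U _ _ _ (proj1 (pullbackP (fmap F (d1 A)) (fmap F (d0 A)))).
exists (fmap F c ∘ k); rewrite !compA -!fmap_comp c0 c1 !fmap_comp.
by rewrite -!compA k0 k1.
Qed.
Lemma act_sym_ex A : exists t : hom (F (ob1 A)) (F (ob1 A)),
  fmap F (d0 A) ∘ t = fmap F (d1 A) /\ fmap F (d1 A) ∘ t = fmap F (d0 A).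
Proof.
by have [t [t0 t1]] := sym_ex A; exists (fmap F t); rewrite -!fmap_comp t0 t1.
Qed.

Definition act_obj A : eqv_2gpd D :=
  @Eqv2Gpd D (F (ob0 A)) (F (ob1 A)) (fmap F (d0 A)) (fmap F (d1 A))
    (fmap F (sigma A)) (act_d0_sigma A) (act_d1_sigma A) (act_mul_ex A) (act_sym_ex A).

Lemma act_homE A B (f : eqv_2gpd_hom A B) :
  pairing (d0 (act_obj B)) (d1 (act_obj B)) ∘ fmap F (hom1 f) =
  prod_hom (fmap F (hom0 f)) (fmap F (hom0 f)) ∘
    pairing (d0 (act_obj A)) (d1 (act_obj A)).
Proof.
apply: (proj2 (@eqv_2gpd_homE D (act_obj A) (act_obj B) _ _)).
by rewrite /= -!fmap_comp hom_d0 hom_d1.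
Qed.

Definition act_hom A B (f : eqv_2gpd_hom A B) : eqv_2gpd_hom (act_obj A) (act_obj B) :=
  @Eqv2GpdHom D (act_obj A) (act_obj B) (fmap F (hom0 f)) (fmap F (hom1 f)) (act_homE f).

Lemma act_related A w (x y : hom w (ob0 A)) :
  related x y -> related (A := act_obj A) (fmap F x) (fmap F y).
Proof. by move=> [h [<- <-]]; exists (fmap F h); rewrite !fmap_comp. Qed.

Definition act_map A B (c : @hom (Eh2_cat C) A B) :
  @hom (Eh2_cat D) (act_obj A) (act_obj B) := hclass (act_hom (hrepr c)).

Lemma act_mapE A B (f : eqv_2gpd_hom A B) : act_map (hclass f) = hclass (act_hom f).
Proof. by apply/hclassP/act_related/hclassP; rewrite hreprK. Qed.

Lemma act_map_id A : act_map (idm (A : Eh2_cat C)) = idm (act_obj A : Eh2_cat D).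
Proof. by rewrite hclass_id act_mapE; apply: hclass_eq; rewrite /= fmap_id. Qed.

Lemma act_map_comp A B E (g : @hom (Eh2_cat C) B E) (f : @hom (Eh2_cat C) A B) :
  act_map (g ∘ f) = act_map g ∘ act_map f.
Proof.
have [{}f ->] := hclassW f; have [{}g ->] := hclassW g.
by rewrite hclassE !act_mapE hclassE; apply: hclass_eq; rewrite /= fmap_comp.
Qed.

Definition Eh2_fun : functor (Eh2_cat C) (Eh2_cat D) :=
  @Functor (Eh2_cat C) (Eh2_cat D) act_obj act_map act_map_id act_map_comp.

Lemma act_eqv_gpd A : eqv_gpd A -> eqv_gpd (act_obj A).
Proof.
move=> mA; have mF := preserves_monic (lex_funP F) mA.
have pF := preserves_product (lex_catP C) (lex_funP F) (@productP C (ob0 A) (ob0 A)).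
move=> w u v; rewrite !pairing_comp => /pairing_eq [e0 e1]; apply: mF.
have [k [_ ku]] := pF _ (fmap F (d0 A) ∘ v) (fmap F (d1 A) ∘ v).
rewrite -(ku (fmap F (pairing (d0 A) (d1 A)) ∘ u)); last first.
  by rewrite /= !compA -!fmap_comp pairing_fst pairing_snd.
by rewrite -(ku (fmap F _ ∘ v)) // /= !compA -!fmap_comp pairing_fst pairing_snd.
Qed.

Definition Eh_fun : functor (Eh_cat C) (Eh_cat D) :=
  @Functor (Eh_cat C) (Eh_cat D)
    (fun x : Eh_cat C => exist _ (act_obj (sval x)) (act_eqv_gpd (svalP x)))
    (fun x y f => act_map f) (fun x => act_map_id (sval x))
    (fun _ _ _ g f => act_map_comp g f).

Lemma act_pullback (x y z : C) (f : hom x z) (g : hom y z) : exists s : span x y,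
  is_pullback f g s /\ is_pullback (fmap F f) (fmap F g) (fmap_span F s).
Proof.
exists (pullback f g); split; first exact: pullbackP.
exact/(preserves_pullback (lex_funP F))/pullbackP.
Qed.

Lemma act_restriction (x y z : C) (s t : hom y z) (p : hom x z) :
  exists r (s' t' : hom r x) (a : hom r y), is_restriction s t p s' t' a /\
  is_restriction (fmap F s) (fmap F t) (fmap F p) (fmap F s') (fmap F t') (fmap F a).
Proof.
have [s1 [p1 F1]] := act_pullback p s.
have [s2 [p2 F2]] := act_pullback (t ∘ ssnd s1) p.
exists s2, (sfst s1 ∘ sfst s2), (ssnd s2), (ssnd s1 ∘ sfst s2); split.
  exact: restriction_of_pullbacks.
by rewrite fmap_comp in F2; rewrite !fmap_comp; apply: (restriction_of_pullbacks F1 F2).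
Qed.

Lemma act_two_restriction (x y z y' z' : C) (s t : hom y z) (p : hom x z)
    (s' t' : hom y' z') (p' : hom x z') :
  exists r (m n : hom r x) (a : hom r y) (a' : hom r y'),
  is_two_restriction s t p s' t' p' m n a a' /\
  is_two_restriction (fmap F s) (fmap F t) (fmap F p) (fmap F s') (fmap F t')
    (fmap F p') (fmap F m) (fmap F n) (fmap F a) (fmap F a').
Proof.
have [r [m [n [a [R FR]]]]] := act_restriction s t p.
have [r' [m' [n' [a' [R' FR']]]]] := act_restriction s' t' p'.
have FP := preserves_product (lex_catP C) (lex_funP F) (@productP C x x).
have [q [Q FQ]] := act_pullback (pairing m n) (pairing m' n').
exists q, (m ∘ sfst q), (n ∘ sfst q), (a ∘ sfst q), (a' ∘ ssnd q); split.
  by apply: (two_restriction_of_restrictions R R' (@productP C x x) _ _ _ _ Q);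
    rewrite ?pairing_fst ?pairing_snd.
rewrite !fmap_comp; apply: (two_restriction_of_restrictions FR FR' FP _ _ _ _ FQ);
  by rewrite /= -fmap_comp ?pairing_fst ?pairing_snd.
Qed.

Lemma Eh2_fun_pullback (A B E : Eh2_cat C) (f : hom A E) (g : hom B E) :
  exists P : span A B,
  [/\ is_pullback f g P,
      is_pullback (fmap Eh2_fun f) (fmap Eh2_fun g) (fmap_span Eh2_fun P) &
      eqv_gpd A -> eqv_gpd B -> eqv_gpd (P : Eh2_cat C)].
Proof.
have [{}f ->] := hclassW f; have [{}g ->] := hclassW g.
have [s1 [p1 F1]] := act_pullback (hom0 f) (d0 E).
have [s2 [p2 F2]] := act_pullback (d1 E ∘ ssnd s1) (hom0 g).
pose p0 := sfst s1 ∘ sfst s2; pose q0 := ssnd s2.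
have [r [m [n [a [b [R FR]]]]]] := act_two_restriction (d0 A) (d1 A) p0 (d0 B) (d1 B) q0.
have [a0 a1 b0 b1 RU] := R.
have relr w (u v : hom w s2) : related (A := A) (p0 ∘ u) (p0 ∘ v) ->
    related (A := B) (q0 ∘ u) (q0 ∘ v) -> exists k : hom w r, m ∘ k = u /\ n ∘ k = v.
  move=> [h [h0 h1]] [k [k0 k1]]; have [l [[lm ln _ _] _]] := RU _ _ _ _ _ h0 h1 k0 k1.
  by exists l.
have mnp : related (A := A) (p0 ∘ m) (p0 ∘ n) by exists a.
have mnq : related (A := B) (q0 ∘ m) (q0 ∘ n) by exists b.
have r_refl : exists g : hom s2 r, m ∘ g = idm s2 /\ n ∘ g = idm s2.
  by apply: relr; apply: related_refl.
have r_sym : exists g : hom r r, m ∘ g = n /\ n ∘ g = m.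
  by apply: relr; apply: related_sym.
have r_trans w (c d : hom w r) : n ∘ c = m ∘ d ->
    exists k : hom w r, m ∘ k = m ∘ c /\ n ∘ k = n ∘ d.
  move=> e; apply: relr.
    apply: (@related_trans _ A _ _ (p0 ∘ (n ∘ c))).
      by rewrite !compA; apply: related_comp.
    by rewrite e !compA; apply: related_comp.
  apply: (@related_trans _ B _ _ (q0 ∘ (n ∘ c))).
    by rewrite !compA; apply: related_comp.
  by rewrite e !compA; apply: related_comp.
pose P := mk_2gpd r_refl r_sym r_trans.
have [|p pE] := @ex_hom C P A p0; first by exists a.
have [|q qE] := @ex_hom C P B q0; first by exists b.
exists (Span (sapex := P : Eh2_cat C) (hclass p) (hclass q)); split.
- apply: Eh2_pullback => [|w u v|w s t]; rewrite ?pE ?qE.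
  + exists (ssnd s1 ∘ sfst s2); rewrite !compA (proj1 p1); split=> //.
    exact: (proj1 p2).
  + move=> [h [h0 h1]]; have [k [[k1 k2] _]] := proj2 p1 _ _ _ (esym h0).
    have [|l [[l1 l2] _]] := proj2 p2 _ k v; first by rewrite -compA k2.
    by exists l; rewrite -!compA l1 k1.
  + by move=> st1 st2; have [k kE] := relr _ _ _ st1 st2; exists k.
- rewrite /= /fmap_span /= !act_mapE.
  apply: Eh2_pullback => [|w u v|w s t]; rewrite /= ?pE ?qE.
  + rewrite -!fmap_comp; apply: act_related.
    exists (ssnd s1 ∘ sfst s2); rewrite !compA (proj1 p1); split=> //.
    exact: (proj1 p2).
  + move=> [h [h0 h1]]; have [k [[/= k1 k2] _]] := proj2 F1 _ _ _ (esym h0).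
    have [|l [[/= l1 l2] _]] := proj2 F2 _ k v; first by rewrite fmap_comp -compA k2.
    by exists l; rewrite fmap_comp -!compA l1 k1.
  + move=> [h [h0 h1]] [k [k0 k1]]; have [_ _ _ _ FU] := FR.
    by have [l [[lm ln _ _] _]] := FU _ _ _ _ _ h0 h1 k0 k1; exists l.
- move=> mA mB w u v; rewrite !pairing_comp => /pairing_eq [/= e0 e1].
  have [k [_ kk]] := RU w (m ∘ v) (n ∘ v) (a ∘ v) (b ∘ v)
    (ltac:(by rewrite !compA a0)) (ltac:(by rewrite !compA a1))
    (ltac:(by rewrite !compA b0)) (ltac:(by rewrite !compA b1)).
  transitivity k; last by apply: kk.
  apply/esym/kk; split=> //.
    apply: mA; rewrite !pairing_comp; apply/pairing_eq.
    by rewrite !compA a0 a1 -!compA e0 e1.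
  apply: mB; rewrite !pairing_comp; apply/pairing_eq.
  by rewrite !compA b0 b1 -!compA e0 e1.
Qed.
End Action.

Lemma full_subcategory_pullback (K : category) (Q : K -> Prop)
    (x y z : full_subcategory Q) (f : hom x z) (g : hom y z)
    (s : span (sval x) (sval y)) (Qs : Q s) :
  @is_pullback K _ _ _ f g s ->
  is_pullback f g (@Span (full_subcategory Q) x y (exist _ _ Qs) (sfst s) (ssnd s)).
Proof. by move=> [e U]; split=> // w a b; apply: U. Qed.

Lemma terminal_obj (C : lex_category) : exists t : C, is_terminal t.
Proof. exact: lex_terminal (lex_catP C). Qed.

Section Unit.
Variable C : lex_category.

Lemma unit_mul_ex (x : C) : let q := pullback (idm x) (idm x) in
  exists c : hom q x, idm x ∘ c = idm x ∘ sfst q /\ idm x ∘ c = idm x ∘ ssnd q.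
Proof. by move=> q; exists (sfst q); split=> //; apply: (proj1 (pullbackP _ _)). Qed.
Lemma unit_sym_ex (x : C) : exists t : hom x x, idm x ∘ t = idm x /\ idm x ∘ t = idm x.
Proof. by exists (idm x); rewrite comp_idl. Qed.

Definition unit_obj (x : C) : eqv_2gpd C :=
  @Eqv2Gpd C x x (idm x) (idm x) (idm x) (comp_idl _) (comp_idl _)
    (unit_mul_ex x) (unit_sym_ex x).

Lemma unit_homE (x y : C) (f : hom x y) :
  idm y ∘ f = f ∘ idm x.
Proof. by rewrite comp_idl comp_idr. Qed.

Definition unit_hom (x y : C) (f : hom x y) : eqv_2gpd_hom (unit_obj x) (unit_obj y) :=
  @mk_hom C (unit_obj x) (unit_obj y) f f (unit_homE f) (unit_homE f).

Lemma related_unit x w (a b : hom w x) : related (A := unit_obj x) a b <-> a = b.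
Proof.
split=> [[h [/= <- <-]] //|->]; exact: related_refl.
Qed.

Definition Eh2_unit_map (x y : C) (f : hom x y) :
  @hom (Eh2_cat C) (unit_obj x) (unit_obj y) := hclass (unit_hom f).

Lemma Eh2_unit_map_id x : Eh2_unit_map (idm x) = idm (unit_obj x : Eh2_cat C).
Proof. by rewrite hclass_id; apply: hclass_eq. Qed.
Lemma Eh2_unit_map_comp x y z (g : hom y z) (f : hom x y) :
  Eh2_unit_map (g ∘ f) = Eh2_unit_map g ∘ Eh2_unit_map f.
Proof. by rewrite hclassE; apply: hclass_eq. Qed.

Definition Eh2_unit : functor C (Eh2_cat C) :=
  @Functor C (Eh2_cat C) unit_obj Eh2_unit_map Eh2_unit_map_id Eh2_unit_map_comp.

Lemma unit_eqv_gpd x : eqv_gpd (unit_obj x).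
Proof.
by move=> w u v; rewrite !pairing_comp => /pairing_eq [/=]; rewrite !comp_idl.
Qed.

Definition Eh_unit : functor C (Eh_cat C) :=
  @Functor C (Eh_cat C) (fun x => exist _ (unit_obj x) (@unit_eqv_gpd x))
    Eh2_unit_map Eh2_unit_map_id Eh2_unit_map_comp.

Lemma Eh2_unit_pullback (x y z : C) (f : hom x z) (g : hom y z) (s : span x y) :
  is_pullback f g s ->
  is_pullback (fmap Eh2_unit f) (fmap Eh2_unit g) (fmap_span Eh2_unit s).
Proof.
move=> [e U]; apply: Eh2_pullback => /= [|w a b /related_unit ab|w u v /related_unit uv].
- exact/related_unit.
- by have [k [kE _]] := U _ _ _ ab; exists k.
move=> /related_unit uv'; apply/(@related_unit s).
have [|k [_ kk]] := U w (sfst s ∘ v) (ssnd s ∘ v); first by rewrite !compA e.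
transitivity k; last exact: kk.
by apply/esym/kk.
Qed.
End Unit.

Section LexStructure.
Variable C : lex_category.

Lemma Eh2_cat_lex : has_finite_limits (Eh2_cat C).
Proof.
apply: finite_limits_of_pullbacks => [|A B E f g].
  by have [t tt] := terminal_obj C; exists (unit_obj t); apply: Eh2_terminal.
by have [P [PP _ _]] := Eh2_fun_pullback (lex_id C) f g; exists P.
Qed.

Lemma Eh_cat_lex : has_finite_limits (Eh_cat C).
Proof.
apply: finite_limits_of_pullbacks => [|A B E f g].
  have [t tt] := terminal_obj C; exists (fobj (Eh_unit C) t) => B.
  exact: (@Eh2_terminal C (unit_obj t) tt (sval B)).
have [P [PP _ mP]] := @Eh2_fun_pullback _ _ (lex_id C) (sval A) (sval B) (sval E) f g.
by eexists; apply: (full_subcategory_pullback (mP (svalP A) (svalP B)) PP).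
Qed.

Definition Eh2 : lex_category := LexCategory Eh2_cat_lex.
Definition Eh : lex_category := LexCategory Eh_cat_lex.

Lemma Eh2_unit_lex : preserves_finite_limits (Eh2_unit C).
Proof.
apply: preserves_of_pullbacks => [|x y z f g].
  by have [t tt] := terminal_obj C; exists t; split=> //; apply: Eh2_terminal.
exists (pullback f g); split; first exact: pullbackP.
exact/Eh2_unit_pullback/pullbackP.
Qed.

Lemma Eh_unit_lex : preserves_finite_limits (Eh_unit C).
Proof.
apply: preserves_of_pullbacks => [|x y z f g].
  have [t tt] := terminal_obj C; exists t; split=> // B.
  exact: (@Eh2_terminal C (unit_obj t) tt (sval B)).
exists (pullback f g); split; first exact: pullbackP.
have := Eh2_unit_pullback (pullbackP f g).
exact: (@full_subcategory_pullback (Eh2_cat C) (@eqv_gpd C) (Eh_unit C x)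
  (Eh_unit C y) (Eh_unit C z)).
Qed.
End LexStructure.

Definition Eh2_eta (C : lex_category) : lex_functor C (Eh2 C) :=
  @LexFunctor C (Eh2 C) (Eh2_unit C) (@Eh2_unit_lex C).
Definition Eh_eta (C : lex_category) : lex_functor C (Eh C) :=
  @LexFunctor C (Eh C) (Eh_unit C) (@Eh_unit_lex C).

Section LexAction.
Variables (C D : lex_category) (F : lex_functor C D).

Lemma Eh2_fun_lex : preserves_finite_limits (Eh2_fun F).
Proof.
apply: preserves_of_pullbacks => [|A B E f g].
  have [t tt] := terminal_obj C; exists (unit_obj t); split; apply: Eh2_terminal => //.
  exact: (preserves_terminal (lex_funP F)).
by have [P [PP FP _]] := Eh2_fun_pullback F f g; exists P.
Qed.

Lemma Eh_fun_lex : preserves_finite_limits (Eh_fun F).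
Proof.
apply: preserves_of_pullbacks => [|A B E f g].
  have [t tt] := terminal_obj C; exists (Eh_unit C t); split=> B.
    exact: (@Eh2_terminal C (unit_obj t) tt (sval B)).
  apply: (@Eh2_terminal D (act_obj F (unit_obj t)) _ (sval B)).
  exact: (preserves_terminal (lex_funP F)).
have [P [PP FP mP]] := @Eh2_fun_pullback _ _ F (sval A) (sval B) (sval E) f g.
have mP' := mP (svalP A) (svalP B).
eexists; split; first exact: (full_subcategory_pullback mP' PP).
exact: (@full_subcategory_pullback (Eh2_cat D) (@eqv_gpd D) (Eh_fun F A)
  (Eh_fun F B) (Eh_fun F E) (fmap (Eh_fun F) f) (fmap (Eh_fun F) g)
  (fmap_span (Eh2_fun F) P) (@act_eqv_gpd C D F _ mP') FP).
Qed.

Definition Eh2_act : lex_functor (Eh2 C) (Eh2 D) :=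
  @LexFunctor (Eh2 C) (Eh2 D) (Eh2_fun F) Eh2_fun_lex.
Definition Eh_act : lex_functor (Eh C) (Eh D) :=
  @LexFunctor (Eh C) (Eh D) (Eh_fun F) Eh_fun_lex.
End LexAction.

Definition is_coequalizer (K : category) (a b c : K) (u v : hom a b) (q : hom b c) :=
  q ∘ u = q ∘ v /\
  forall w (g : hom b w), g ∘ u = g ∘ v -> exists! k : hom c w, k ∘ q = g.

Section PointwiseKan.
Variables (X P Z : lex_category) (i : lex_functor X P) (f : lex_functor X Z).
Variables (L : lex_functor P Z) (th : nat_trans f (functor_comp L i)).

(* [L A] is the colimit of [f x] over the arrows [i x -> A]. *)
Definition pointwise_lan := forall (A : P) (W : Z)
    (c : forall x, hom (i x) A -> hom (f x) W),
  (forall x y (t : hom x y) (p : hom (i y) A), c y p ∘ fmap f t = c x (p ∘ fmap i t)) ->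
  exists! k : hom (L A) W, forall x (p : hom (i x) A), k ∘ (fmap L p ∘ th x) = c x p.

Lemma pointwise_lan_of_coequalizers :
  (forall A : P, exists (a1 a0 : X) (u v : hom a1 a0) (q : hom (i a0) A),
    [/\ q ∘ fmap i u = q ∘ fmap i v,
        forall x (p : hom (i x) A), exists t : hom x a0, p = q ∘ fmap i t &
        is_coequalizer (fmap f u) (fmap f v) (fmap L q ∘ th a0)]) ->
  pointwise_lan.
Proof.
move=> H A W c cn; have [a1 [a0 [u [v [q [quv qt [_ qU]]]]]]] := H A.
have [|k [kq kk]] := qU W (c a0 q); first by rewrite !cn quv.
exists k; split=> [x p|k' k'c]; last exact: kk.
have [t ->] := qt x p; rewrite -cn -kq -!compA.
by congr (_ ∘ _); rewrite fmap_comp -!compA (ncompE th).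
Qed.

Hypothesis LP : pointwise_lan.

Section Desc.
Variables (G : lex_functor P Z) (et : nat_trans f (functor_comp G i)).

Lemma desc_ex (A : P) : exists k : hom (L A) (G A),
  forall x (p : hom (i x) A), k ∘ (fmap L p ∘ th x) = fmap G p ∘ et x.
Proof.
have [|k [kE _]] := @LP A (G A) (fun x p => fmap G p ∘ et x); last by exists k.
by move=> x y t p; rewrite fmap_comp -!compA (ncompE et).
Qed.
Definition desc_map (A : P) : hom (L A) (G A) := sval (cid (desc_ex A)).
Lemma desc_mapE (A : P) x (p : hom (i x) A) :
  desc_map A ∘ (fmap L p ∘ th x) = fmap G p ∘ et x.
Proof. by rewrite /desc_map; case: cid. Qed.

Lemma pointwise_ext (A : P) (W : Z) (k k' : hom (L A) W) :
  (forall x (p : hom (i x) A), k ∘ (fmap L p ∘ th x) = k' ∘ (fmap L p ∘ th x)) -> k = k'.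
Proof.
move=> kk; have [|m [_ mm]] := @LP A W (fun x p => k' ∘ (fmap L p ∘ th x)).
  move=> x y t p; rewrite -!compA (ncompE th) fmap_comp.
  by rewrite -!compA.
by transitivity m; [apply/esym/mm | apply: mm].
Qed.

Lemma desc_nat (A B : P) (a : hom A B) : desc_map B ∘ fmap L a = fmap G a ∘ desc_map A.
Proof.
apply: pointwise_ext => x p.
rewrite -!compA desc_mapE (compA (fmap L a)) -fmap_comp desc_mapE.
by rewrite fmap_comp compA.
Qed.

Definition desc : nat_trans L G := NatTrans desc_nat.
End Desc.

Lemma desc_fac (G : lex_functor P Z) (et : nat_trans f (functor_comp G i)) :
  nat_comp (nat_rwhisker (desc et) i) th = et.
Proof.
apply: nat_trans_ext => x /=.
by have := desc_mapE et (idm (i x)); rewrite !fmap_id !comp_idl.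
Qed.

Lemma desc_uniq (G : lex_functor P Z) (et : nat_trans f (functor_comp G i))
    (a : nat_trans L G) : nat_comp (nat_rwhisker a i) th = et -> a = desc et.
Proof.
move=> aE; apply: nat_trans_ext => A; apply: pointwise_ext => x p /=.
by rewrite desc_mapE -aE /= !compA ncompE.
Qed.

Definition lan_of_pointwise : @lan Lex X P Z i f :=
  @Lan Lex X P Z i f L th desc desc_fac desc_uniq.
End PointwiseKan.

Lemma nat_trans_invertible (C D : lex_category) (F G : lex_functor C D)
    (a : nat_trans F G) :
  (forall x, exists b : hom (G x) (F x), b ∘ a x = idm (F x) /\ a x ∘ b = idm (G x)) ->
  @invertible Lex C D F G a.
Proof.
move=> aI; pose b x := sval (cid (aI x)).
have ba x : b x ∘ a x = idm _ by rewrite /b; case: cid => ? [].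
have ab x : a x ∘ b x = idm _ by rewrite /b; case: cid => ? [].
have bn x y (f : hom x y) : b y ∘ fmap G f = fmap F f ∘ b x.
  by rewrite -[fmap G f]comp_idr -(ab x) !compA -(compA (b y)) -ncompE compA ba comp_idl.
by exists (NatTrans bn); split; apply: nat_trans_ext => x /=.
Qed.

Section Density.
Variable C : lex_category.

Lemma quotient_homE (A : eqv_2gpd C) :
  d0 A ∘ sigma A = idm (ob0 A) ∘ idm (ob0 A) /\
  d1 A ∘ sigma A = idm (ob0 A) ∘ idm (ob0 A).
Proof. by rewrite comp_idl d0_sigma d1_sigma. Qed.

Definition quotient_hom (A : eqv_2gpd C) : eqv_2gpd_hom (unit_obj (ob0 A)) A :=
  @mk_hom C (unit_obj (ob0 A)) A (idm _) (sigma A) (proj1 (quotient_homE A))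
    (proj2 (quotient_homE A)).

Lemma quotient_hom_lift (A : eqv_2gpd C) x (p : @hom (Eh2_cat C) (unit_obj x) A) :
  exists t : hom x (ob0 A), p = hclass (quotient_hom A) ∘ Eh2_unit_map t.
Proof.
have [{}p ->] := hclassW p; exists (hom0 p).
by rewrite hclassE; apply: hclass_eq; rewrite /= comp_idl.
Qed.

Lemma quotient_coequalizer (A : eqv_2gpd C) (q : eqv_2gpd_hom (unit_obj (ob0 A)) A) :
  hom0 q = idm (ob0 A) ->
  is_coequalizer (Eh2_unit_map (d0 A)) (Eh2_unit_map (d1 A)) (hclass q).
Proof.
move=> qE; split=> [|W g].
  by rewrite !hclassE; apply/hclassP; rewrite /= qE !comp_idl; apply: related_d.
have [{}g ->] := hclassW g; rewrite !hclassE => /hclassP gr.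
have [k kE] := ex_hom gr; exists (hclass k); split.
  by rewrite hclassE; apply: hclass_eq; rewrite /= kE qE comp_idr.
move=> l; have [{}l ->] := hclassW l; rewrite hclassE => /hclassP /=.
by rewrite qE comp_idr => lg; apply/hclassP; rewrite kE; apply: related_sym.
Qed.
End Density.

Section Machine.
Variables (C D : lex_category) (F : lex_functor C D).

Lemma act_unit_homE (x : C) : fmap F (idm x) ∘ idm (F x) = idm (F x) ∘ idm (F x).
Proof. by rewrite fmap_id. Qed.

(* [F (unit_obj x)] and [unit_obj (F x)] have the same objects; their structure
   maps are [F (idm x)] and [idm (F x)]. *)
Definition act_unit_hom (x : C) : eqv_2gpd_hom (unit_obj (F x)) (act_obj F (unit_obj x)) :=
  @mk_hom D (unit_obj (F x)) (act_obj F (unit_obj x)) (idm (F x)) (idm (F x))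
    (act_unit_homE x) (act_unit_homE x).

Lemma act_unit_nat (x y : C) (f : hom x y) :
  hclass (act_unit_hom y) ∘ Eh2_unit_map (fmap F f) =
  act_map F (Eh2_unit_map f) ∘ hclass (act_unit_hom x).
Proof.
rewrite act_mapE !hclassE.
by apply: hclass_eq; rewrite /= comp_idl comp_idr.
Qed.

Definition Eh2_theta : nat_trans (functor_comp (Eh2_unit D) F)
    (functor_comp (Eh2_fun F) (Eh2_unit C)) :=
  @NatTrans _ _ (functor_comp (Eh2_unit D) F) (functor_comp (Eh2_fun F) (Eh2_unit C))
    (fun x => hclass (act_unit_hom x)) act_unit_nat.

Definition Eh_theta : nat_trans (functor_comp (Eh_unit D) F)
    (functor_comp (Eh_fun F) (Eh_unit C)) :=
  @NatTrans _ _ (functor_comp (Eh_unit D) F) (functor_comp (Eh_fun F) (Eh_unit C))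
    (fun x => hclass (act_unit_hom x)) act_unit_nat.

Lemma act_quotient_coequalizer (A : eqv_2gpd C) :
  is_coequalizer (Eh2_unit_map (fmap F (d0 A))) (Eh2_unit_map (fmap F (d1 A)))
    (act_map F (hclass (quotient_hom A)) ∘ hclass (act_unit_hom (ob0 A))).
Proof.
rewrite act_mapE hclassE; apply: (@quotient_coequalizer D (act_obj F A)).
by rewrite /= fmap_id comp_idl.
Qed.

Lemma quotient_hom_coeq (A : eqv_2gpd C) :
  hclass (quotient_hom A) ∘ Eh2_unit_map (d0 A) =
  hclass (quotient_hom A) ∘ Eh2_unit_map (d1 A).
Proof. exact: (proj1 (quotient_coequalizer _)). Qed.

Lemma Eh2_pointwise : @pointwise_lan C (Eh2 C) (Eh2 D) (Eh2_eta C)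
  (lex_comp (Eh2_eta D) F) (Eh2_act F) Eh2_theta.
Proof.
apply: pointwise_lan_of_coequalizers => A.
exists (ob1 A), (ob0 A), (d0 A), (d1 A), (hclass (quotient_hom A)); split.
- exact: quotient_hom_coeq.
- exact: quotient_hom_lift.
exact: act_quotient_coequalizer.
Qed.

Lemma Eh_pointwise : @pointwise_lan C (Eh C) (Eh D) (Eh_eta C)
  (lex_comp (Eh_eta D) F) (Eh_act F) Eh_theta.
Proof.
apply: pointwise_lan_of_coequalizers => -[A mA].
exists (ob1 A), (ob0 A), (d0 A), (d1 A), (hclass (quotient_hom A)); split.
- exact: quotient_hom_coeq.
- exact: quotient_hom_lift.
have [e U] := act_quotient_coequalizer A; split; first exact: e.
by move=> -[W mW]; apply: U.
Qed.

Lemma act_unit_iso (x : C) :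
  exists b : @hom (Eh2_cat D) (act_obj F (unit_obj x)) (unit_obj (F x)),
  b ∘ hclass (act_unit_hom x) = idm (unit_obj (F x) : Eh2_cat D) /\
  hclass (act_unit_hom x) ∘ b = idm (act_obj F (unit_obj x) : Eh2_cat D).
Proof.
have [|b bE] := @ex_hom D (act_obj F (unit_obj x)) (unit_obj (F x)) (idm (F x)).
  exact: related_refl.
exists (hclass b); rewrite !hclassE !hclass_id.
by split; apply: hclass_eq; rewrite /= bE comp_idl.
Qed.

Definition Eh2_lan : @lan Lex C (Eh2 C) (Eh2 D) (Eh2_eta C) (lex_comp (Eh2_eta D) F) :=
  lan_of_pointwise Eh2_pointwise.

Definition Eh_lan : @lan Lex C (Eh C) (Eh D) (Eh_eta C) (lex_comp (Eh_eta D) F) :=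
  lan_of_pointwise Eh_pointwise.

Lemma Eh2_lan_inv : invertible (lan_cell Eh2_lan).
Proof. exact/nat_trans_invertible/act_unit_iso. Qed.

Lemma Eh_lan_inv : invertible (lan_cell Eh_lan).
Proof. exact/nat_trans_invertible/act_unit_iso. Qed.
End Machine.

Lemma lan_desc_invertible (B : bicategory) (x y z : B) (p : cell1 x y) (f : cell1 x z)
    (l : lan p f) (g : cell1 y z) (t : cell2 f (comp1 g p)) (a : cell2 (lan_mor l) g) :
  comp2 (rwhisker a p) (lan_cell l) = t -> invertible a -> invertible (lan_desc l t).
Proof. by move=> /lan_uniq <-. Qed.

Section MachineComp.
Variables (C D E : lex_category) (G : lex_functor D E) (F : lex_functor C D).

Definition act_comp_hom (A : eqv_2gpd C) :
  eqv_2gpd_hom (act_obj (lex_comp G F) A) (act_obj G (act_obj F A)) :=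
  @mk_hom E (act_obj (lex_comp G F) A) (act_obj G (act_obj F A)) (idm _) (idm _)
    (eq_trans (comp_idr _) (esym (comp_idl _))) (eq_trans (comp_idr _) (esym (comp_idl _))).

Lemma act_comp_nat (A B : Eh2_cat C) (f : hom A B) :
  hclass (act_comp_hom B) ∘ act_map (lex_comp G F) f =
  act_map G (act_map F f) ∘ hclass (act_comp_hom A).
Proof.
have [{}f ->] := hclassW f; rewrite !act_mapE !hclassE.
by apply: hclass_eq; rewrite /= comp_idl comp_idr.
Qed.

Lemma act_comp_iso (A : eqv_2gpd C) :
  exists b : @hom (Eh2_cat E) (act_obj G (act_obj F A)) (act_obj (lex_comp G F) A),
  b ∘ hclass (act_comp_hom A) = idm (act_obj (lex_comp G F) A : Eh2_cat E) /\
  hclass (act_comp_hom A) ∘ b = idm (act_obj G (act_obj F A) : Eh2_cat E).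
Proof.
have [|b bE] := @ex_hom E (act_obj G (act_obj F A)) (act_obj (lex_comp G F) A) (idm _).
  by rewrite !comp_idl; apply: (related_d (act_obj (lex_comp G F) A)).
exists (hclass b); rewrite !hclassE !hclass_id.
by split; apply: hclass_eq; rewrite /= bE comp_idl.
Qed.

Lemma act_comp_cellE (x : C) :
  hclass (act_comp_hom (unit_obj x)) ∘ hclass (act_unit_hom (lex_comp G F) x) =
  idm (act_obj G (act_obj F (unit_obj x)) : Eh2_cat E) ∘
    act_map G (hclass (act_unit_hom F x)) ∘
    idm (act_obj G (unit_obj (F x)) : Eh2_cat E) ∘
    hclass (act_unit_hom G (F x)) ∘ idm (unit_obj (G (F x)) : Eh2_cat E).
Proof.
rewrite !comp_idr comp_idl act_mapE !hclassE.
by apply: hclass_eq; rewrite /= fmap_id.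
Qed.

Lemma Eh2_lan_comp : invertible
  (lan_comp_cell (B := Lex) (Eh2_lan (lex_comp G F)) (Eh2_lan G) (Eh2_lan F)).
Proof.
pose a : nat_trans (Eh2_fun (lex_comp G F)) (functor_comp (Eh2_fun G) (Eh2_fun F)) :=
  @NatTrans _ _ (Eh2_fun (lex_comp G F)) (functor_comp (Eh2_fun G) (Eh2_fun F))
    (fun A => hclass (act_comp_hom A)) act_comp_nat.
apply: (@lan_desc_invertible Lex C (Eh2 C) (Eh2 E) _ _ (Eh2_lan (lex_comp G F))
  (lex_comp (Eh2_act G) (Eh2_act F)) _ a).
  by apply: nat_trans_ext => x; apply: act_comp_cellE.
by apply: nat_trans_invertible => A; apply: act_comp_iso.
Qed.

Lemma Eh_lan_comp : invertible
  (lan_comp_cell (B := Lex) (Eh_lan (lex_comp G F)) (Eh_lan G) (Eh_lan F)).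
Proof.
pose a : nat_trans (Eh_fun (lex_comp G F)) (functor_comp (Eh_fun G) (Eh_fun F)) :=
  @NatTrans _ _ (Eh_fun (lex_comp G F)) (functor_comp (Eh_fun G) (Eh_fun F))
    (fun A => hclass (act_comp_hom (sval A))) (fun A B f => act_comp_nat f).
apply: (@lan_desc_invertible Lex C (Eh C) (Eh E) _ _ (Eh_lan (lex_comp G F))
  (lex_comp (Eh_act G) (Eh_act F)) _ a).
  by apply: nat_trans_ext => x; apply: act_comp_cellE.
by apply: nat_trans_invertible => A; apply: act_comp_iso.
Qed.
End MachineComp.

Section MachineId.
Variable C : lex_category.

Definition act_id_hom (A : eqv_2gpd C) : eqv_2gpd_hom (act_obj (lex_id C) A) A :=
  @mk_hom C (act_obj (lex_id C) A) A (idm _) (idm _)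
    (eq_trans (comp_idr _) (esym (comp_idl _))) (eq_trans (comp_idr _) (esym (comp_idl _))).

Lemma act_id_nat (A B : Eh2_cat C) (f : hom A B) :
  hclass (act_id_hom B) ∘ act_map (lex_id C) f = f ∘ hclass (act_id_hom A).
Proof.
have [{}f ->] := hclassW f; rewrite !act_mapE !hclassE.
by apply: hclass_eq; rewrite /= comp_idl comp_idr.
Qed.

Lemma act_id_iso (A : eqv_2gpd C) :
  exists b : @hom (Eh2_cat C) A (act_obj (lex_id C) A),
  b ∘ hclass (act_id_hom A) = idm (act_obj (lex_id C) A : Eh2_cat C) /\
  hclass (act_id_hom A) ∘ b = idm (A : Eh2_cat C).
Proof.
have [|b bE] := @ex_hom C A (act_obj (lex_id C) A) (idm _).
  by rewrite !comp_idl; apply: (related_d (act_obj (lex_id C) A)).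
exists (hclass b); rewrite !hclassE !hclass_id.
by split; apply: hclass_eq; rewrite /= bE comp_idl.
Qed.

Lemma act_id_cellE (x : C) :
  hclass (act_id_hom (unit_obj x)) ∘ hclass (act_unit_hom (lex_id C) x) =
  idm (unit_obj x : Eh2_cat C) ∘ idm (unit_obj x : Eh2_cat C).
Proof.
by rewrite !comp_idr hclassE hclass_id; apply: hclass_eq; rewrite /= comp_idl.
Qed.

Lemma Eh2_lan_id : invertible (lan_id_cell (B := Lex) (Eh2_lan (lex_id C))).
Proof.
pose a : nat_trans (Eh2_fun (lex_id C)) (functor_id (Eh2 C)) :=
  @NatTrans _ _ (Eh2_fun (lex_id C)) (functor_id (Eh2 C))
    (fun A => hclass (act_id_hom A)) act_id_nat.
apply: (@lan_desc_invertible Lex C (Eh2 C) (Eh2 C) _ _ (Eh2_lan (lex_id C))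
  (lex_id (Eh2 C)) _ a).
  by apply: nat_trans_ext => x; apply: act_id_cellE.
by apply: nat_trans_invertible => A; apply: act_id_iso.
Qed.

Lemma Eh_lan_id : invertible (lan_id_cell (B := Lex) (Eh_lan (lex_id C))).
Proof.
pose a : nat_trans (Eh_fun (lex_id C)) (functor_id (Eh C)) :=
  @NatTrans _ _ (Eh_fun (lex_id C)) (functor_id (Eh C))
    (fun A => hclass (act_id_hom (sval A))) (fun A B f => act_id_nat f).
apply: (@lan_desc_invertible Lex C (Eh C) (Eh C) _ _ (Eh_lan (lex_id C))
  (lex_id (Eh C)) _ a).
  by apply: nat_trans_ext => x; apply: act_id_cellE.
by apply: nat_trans_invertible => A; apply: act_id_iso.
Qed.
End MachineId.

Definition Eh2_machine : kz_machine Lex :=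
  @KZMachine Lex Eh2 Eh2_eta Eh2_lan Eh2_lan_inv Eh2_lan_comp Eh2_lan_id.

Definition Eh_machine : kz_machine Lex :=
  @KZMachine Lex Eh Eh_eta Eh_lan Eh_lan_inv Eh_lan_comp Eh_lan_id.

(* Main.v *)
(** An object of either completion of [X] is the quotient, in the completion, of a
   pair [d0, d1] of maps of [X]. A KZ-algebra structure on [Y] therefore amounts to a
   lex left adjoint of the unit of [Y], sending such an object to the coequalizer of
   [d0, d1] in [Y], and linearity of a lex functor means preserving these
   coequalizers. For strict equivalence relations, lexness of the left adjoint makes
   [Y] exact: quotients are effective and stable. In an exact category the image [R]
   of [A_1 -> A_0 * A_0] is an equivalence relation with the same coequalizer as [A],
   and [A_1 -> R] is the quotient of its kernel pair; so all quotients of equivalence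
   2-groupoids exist, are preserved whenever quotients of equivalence relations are,
   and effectiveness up to a cover shows that forming them is lex. *)
From mathcomp Require Import all_boot.
From mathcomp Require Import boolp.
Require Import Defs.

Set Implicit Arguments.
Unset Strict Implicit.
Unset Printing Implicit Defensive.
Local Open Scope cat_scope.

(** * Isomorphisms and coequalizers in a category *)

Definition is_iso (C : category) (x y : C) (f : hom x y) :=
  exists g : hom y x, g ∘ f = idm x /\ f ∘ g = idm y.

Lemma is_iso_comp (C : category) (x y z : C) (g : hom y z) (f : hom x y) :
  is_iso g -> is_iso f -> is_iso (g ∘ f).
Proof.
move=> [g' [g'g gg']] [f' [f'f ff']]; exists (f' ∘ g').
by rewrite !compA -(compA f') g'g comp_idr f'f -(compA g) ff' comp_idr gg'.
Qed.

Lemma is_iso_fmap (C D : category) (F : functor C D) (x y : C) (f : hom x y) :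
  is_iso f -> is_iso (fmap F f).
Proof. by move=> [g [gf fg]]; exists (fmap F g); rewrite -!fmap_comp gf fg !fmap_id. Qed.

Lemma is_iso_invertible (C D : lex_category) (F G : lex_functor C D) (a : nat_trans F G) :
  @invertible Lex C D F G a <-> forall x, is_iso (a x).
Proof.
split=> [[b [ba ab]] x|]; last exact: nat_trans_invertible.
exists (b x); split; first exact: (congr1 (fun c : nat_trans F F => c x) ba).
exact: (congr1 (fun c : nat_trans G G => c x) ab).
Qed.

Section Coequalizers.
Variables (C : category) (a b : C) (u v : hom a b).

Lemma coequalizer_epi c (q : hom b c) : is_coequalizer u v q ->
  forall w (g h : hom c w), g ∘ q = h ∘ q -> g = h.
Proof.
move=> [qe qu] w g h gh; have [|k [_ ku]] := qu w (h ∘ q); first by rewrite -!compA qe.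
by rewrite -(ku g) // -(ku h).
Qed.

Lemma coequalizer_iso c (q : hom b c) d (k : hom c d) :
  is_coequalizer u v q -> is_iso k -> is_coequalizer u v (k ∘ q).
Proof.
move=> cq [l [lk kl]]; have [qe qu] := cq; split=> [|w g guv].
  by rewrite -!compA qe.
have [m [mq mu]] := qu w g guv.
exists (m ∘ l); split=> [|n nk]; first by rewrite compA -(compA m) lk comp_idr.
by rewrite (mu (n ∘ k)) -?compA ?kl ?comp_idr.
Qed.

Lemma iso_of_coequalizers c (q : hom b c) d (k : hom c d) :
  is_coequalizer u v q -> is_coequalizer u v (k ∘ q) -> is_iso k.
Proof.
move=> cq ckq; have [l [lkq _]] := proj2 ckq c q (proj1 cq).
exists l; split; first by apply: (coequalizer_epi cq); rewrite -compA lkq comp_idl.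
by apply: (coequalizer_epi ckq); rewrite -compA lkq comp_idl.
Qed.

Lemma coequalizer_unique c (q : hom b c) d (q' : hom b d) :
  is_coequalizer u v q -> is_coequalizer u v q' -> exists2 k, is_iso k & q' = k ∘ q.
Proof.
move=> cq cq'; have [k [kq _]] := proj2 cq d q' (proj1 cq').
by exists k => //; apply: (iso_of_coequalizers cq); rewrite kq.
Qed.
End Coequalizers.

(** * KZ-machines on lex categories *)

Definition lex_left_adjoint (C D : lex_category) (i : lex_functor C D) :=
  exists (L : lex_functor D C) (eta : nat_trans (functor_id D) (functor_comp i L)),
  forall A W (g : hom A (i W)), exists! k : hom (L A) W, fmap i k ∘ eta A = g.

Section Machine.
Variable K : kz_machine Lex.

Definition kz_cat (X : lex_category) : lex_category := kz_obj K X.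
Definition kz_eta (X : lex_category) : lex_functor X (kz_cat X) := kz_unit K X.
Definition kz_map (X Y : lex_category) (f : lex_functor X Y) :
  lex_functor (kz_cat X) (kz_cat Y) := lan_mor (kz_mor K f).
Definition kz_cell (X Y : lex_category) (f : lex_functor X Y) :
  nat_trans (functor_comp (kz_eta Y) f) (functor_comp (kz_map f) (kz_eta X)) :=
  lan_cell (kz_mor K f).

Lemma kz_cell_iso (X Y : lex_category) (f : lex_functor X Y) (x : X) :
  is_iso (kz_cell f x).
Proof.
move: x; apply/(is_iso_invertible (F := lex_comp _ _) (G := lex_comp _ _)).
exact: (kz_mor_inv K f).
Qed.

Lemma kz_map_comp (X Y Z : lex_category) (g : lex_functor Y Z) (f : lex_functor X Y) :
  exists a : nat_trans (kz_map (lex_comp g f)) (functor_comp (kz_map g) (kz_map f)),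
    (forall A, is_iso (a A)) /\
    (forall x, a (kz_eta X x) ∘ kz_cell (lex_comp g f) x =
       fmap (kz_map g) (kz_cell f x) ∘ kz_cell g (f x)).
Proof.
exists (lan_comp_cell (kz_mor K (lex_comp g f)) (kz_mor K g) (kz_mor K f)); split.
  exact/(is_iso_invertible (G := lex_comp _ _))/(kz_mor_comp K g f).
move=> x.
have := congr1 (fun c : nat_trans _ _ => c x) (lan_fac (kz_mor K (lex_comp g f))
  (assoc _ _ _ • (lan_mor (kz_mor K g) ◁ lan_cell (kz_mor K f)) • assocV _ _ _
   • (lan_cell (kz_mor K g) ▷ f) • assoc _ _ _)%bicat).
by rewrite /= !comp_idr comp_idl.
Qed.

(** Since [kz_mor_id] makes the comparison of [kz_map] of the identity with the identity invertible,
    the identity of [kz_cat K Y] is itself a left Kan extension of the unit along the unit. *)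
Lemma kz_eta_lan (Y : lex_category) (G : lex_functor (kz_cat Y) (kz_cat Y))
    (t : nat_trans (kz_eta Y) (functor_comp G (kz_eta Y))) :
  exists a : nat_trans (functor_id (kz_cat Y)) G, forall y, a (kz_eta Y y) = t y.
Proof.
have [b [bc _]] := kz_mor_id K Y.
pose M := kz_mor K (id1 (Y : Lex)).
pose tr := nat_comp t (nat_runit (kz_eta Y)).
exists (nat_comp (lan_desc M (g := G) tr) b) => y.
have := congr1 (fun c : nat_trans _ _ => c y) (lan_fac M (g := G) tr).
have := congr1 (fun c : nat_trans _ _ => c y)
  (lan_fac M (g := id1 _) (lunitorV (kz_unit K Y) • runitor (kz_unit K Y))%bicat).
have := congr1 (fun c : nat_trans _ _ => c (kz_eta Y y)) bc.
rewrite /= !comp_idr /= => bcy faci <-.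
have e : b (kz_eta Y y) = lan_cell M y.
  by rewrite -[LHS]comp_idr -[RHS]comp_idl -bcy -faci compA.
by rewrite /= e.
Qed.

Lemma lex_lan_ext (X P Z : lex_category) (p : lex_functor X P) (f : lex_functor X Z)
    (l : @lan Lex X P Z p f) (G : lex_functor P Z) (a b : nat_trans (lan_mor l) G) :
  (forall x, a (p x) ∘ lan_cell l x = b (p x) ∘ lan_cell l x) -> forall A, a A = b A.
Proof.
move=> ab A; congr (ncomp _ A).
pose t : nat_trans f (functor_comp G p) := nat_comp (nat_rwhisker b p) (lan_cell l).
transitivity (lan_desc l (g := G) t); last by symmetry; apply: (@lan_uniq Lex _ _ _ _ _ l G t).
by apply: (@lan_uniq Lex _ _ _ _ _ l G t); apply: nat_trans_ext => x; apply: ab.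
Qed.

(** The multiplication [alg_mul] is the left adjoint: the inverse of its Kan cell is the counit, and
    the unit of the adjunction is obtained by extending the whiskered Kan cell [t] from the objects
    [kz_eta K Y y]. *)
Lemma cocomplete_adjoint (Y : lex_category) :
  cocomplete K Y -> lex_left_adjoint (kz_eta Y).
Proof.
move=> [alg].
pose L : lex_functor (kz_cat Y) Y := lan_mor (alg_mul alg).
pose th : nat_trans (functor_id Y) (functor_comp L (kz_eta Y)) := lan_cell (alg_mul alg).
have [ep [epth thep]] : invertible (lan_cell (alg_mul alg)) by apply: alg_ext_inv.
have {}epth y : ep y ∘ th y = idm y := congr1 (fun c : nat_trans _ _ => c y) epth.
have {}thep y : th y ∘ ep y = idm _ := congr1 (fun c : nat_trans _ _ => c y) thep.
pose t : nat_trans (kz_eta Y) (functor_comp (lex_comp (kz_eta Y) L) (kz_eta Y)) :=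
  @NatTrans _ _ (kz_eta Y) (functor_comp (lex_comp (kz_eta Y) L) (kz_eta Y))
    (fun y => fmap (kz_eta Y) (th y)) (fun y z f => ncompE (nat_lwhisker (kz_eta Y) th) f).
have [eta etaE] := kz_eta_lan t.
exists L, eta.
(* A triangle identity. Both sides are natural in [A], hence 2-cells out of the Kan extension [L],
   so it is enough to compare them at the objects [kz_eta K Y y] after the Kan cell. *)
have tri A : ep (L A) ∘ fmap L (eta A) = idm (L A).
  have aE B D (f : hom B D) :
      (ep (L D) ∘ fmap L (eta D)) ∘ fmap L f = fmap L f ∘ (ep (L B) ∘ fmap L (eta B)).
    rewrite -compA -fmap_comp; have /= -> := ncompE eta f.
    by rewrite fmap_comp !compA; have /= -> := ncompE ep (fmap L f).
  apply: (lex_lan_ext (l := alg_mul alg) (a := NatTrans aE) (b := nat_id L)) => y /=.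
  rewrite comp_idl etaE /= -!compA.
  have /= <- := ncompE th (th y).
  by rewrite compA epth comp_idl.
move=> A W g; exists (ep W ∘ fmap L g); split=> [|k <-].
  have /= := ncompE eta g.
  rewrite fmap_comp -compA => <-.
  by rewrite etaE /= compA -fmap_comp epth fmap_id comp_idl.
rewrite fmap_comp compA.
have /= -> := ncompE ep k.
by rewrite -compA tri comp_idr.
Qed.
End Machine.

(* Every object of [K X] is, canonically in the lex functors out of [X], the
   quotient of an equivalence 2-groupoid in [X]. *)
Record presentation (K : kz_machine Lex) := Presentation {
  pr_gpd : forall X : lex_category, kz_cat K X -> eqv_2gpd X;
  pr_quot : forall (X : lex_category) (A : kz_cat K X),
    hom (kz_eta K X (ob0 (pr_gpd A))) A;
  pr_quot_eq : forall (X : lex_category) (A : kz_cat K X),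
    pr_quot A ∘ fmap (kz_eta K X) (d0 _) = pr_quot A ∘ fmap (kz_eta K X) (d1 _);
  pr_quot_lift : forall (X : lex_category) (A : kz_cat K X) x (p : hom (kz_eta K X x) A),
    exists t, p = pr_quot A ∘ fmap (kz_eta K X) t;
  pr_map_quot : forall (X Z : lex_category) (f : lex_functor X Z) (A : kz_cat K X),
    is_coequalizer (fmap (kz_eta K Z) (fmap f (d0 (pr_gpd A))))
      (fmap (kz_eta K Z) (fmap f (d1 (pr_gpd A))))
      (fmap (kz_map K f) (pr_quot A) ∘ kz_cell K f _);
  pr_eta_ff : forall (X : lex_category) (x y : X) (g : hom (kz_eta K X x) (kz_eta K X y)),
    exists! t, fmap (kz_eta K X) t = g }.

(** Stated for every coequalizer of [d0] and [d1], so that it depends on no chosen quotient and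
    makes sense before quotients are known to exist. *)
Definition preserves_quotient (X Y : lex_category) (f : lex_functor X Y) (A : eqv_2gpd X) :=
  forall Q (q : hom (ob0 A) Q), is_coequalizer (d0 A) (d1 A) q ->
  is_coequalizer (fmap f (d0 A)) (fmap f (d1 A)) (fmap f q).

(** * Algebras and linear functors of a presented machine *)

Section Presented.
Variables (K : kz_machine Lex) (R : presentation K).

(** The pointwise Kan extension formula with the colimit over all arrows from unit objects to [A]
    replaced by the single coequalizer that presents [A]. *)
Definition quotient_lan (X Z : lex_category) (f : lex_functor X Z)
    (L : lex_functor (kz_cat K X) Z) (th : nat_trans f (functor_comp L (kz_eta K X))) :=
  forall A : kz_cat K X, is_coequalizer (fmap f (d0 (pr_gpd R A)))
    (fmap f (d1 (pr_gpd R A))) (fmap L (pr_quot R A) ∘ th (ob0 (pr_gpd R A))).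

Lemma quotient_lan_pointwise (X Z : lex_category) (f : lex_functor X Z)
    (L : lex_functor (kz_cat K X) Z) (th : nat_trans f (functor_comp L (kz_eta K X))) :
  quotient_lan th -> pointwise_lan th.
Proof.
move=> Lth; apply: pointwise_lan_of_coequalizers => A.
exists (ob1 (pr_gpd R A)), (ob0 (pr_gpd R A)), (d0 _), (d1 _), (pr_quot R A).
split; [exact: pr_quot_eq | exact: pr_quot_lift | exact: Lth].
Qed.

Section Adjoint.
Variables (Y : lex_category) (L : lex_functor (kz_cat K Y) Y).
Variable eta : nat_trans (functor_id (kz_cat K Y)) (functor_comp (kz_eta K Y) L).
Hypothesis etaU : forall A W (g : hom A (kz_eta K Y W)),
  exists! k : hom (L A) W, fmap (kz_eta K Y) k ∘ eta A = g.

Lemma eta_inj (x y : Y) (s t : hom x y) : fmap (kz_eta K Y) s = fmap (kz_eta K Y) t -> s = t.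
Proof.
move=> st; have [u [_ uu]] := pr_eta_ff R (fmap (kz_eta K Y) t).
by rewrite -(uu s) // -(uu t).
Qed.

(** The inverse of the counit: the unit [eta] at [kz_eta K Y y] goes between unit objects, so it
    comes from a map of [Y] by full faithfulness. *)
Definition section_map (y : Y) : hom y (L (kz_eta K Y y)) :=
  sval (cid (pr_eta_ff R (eta (kz_eta K Y y)))).
Lemma section_mapE (y : Y) : fmap (kz_eta K Y) (section_map y) = eta (kz_eta K Y y).
Proof. by rewrite /section_map; case: cid => t []. Qed.

Lemma section_map_nat (x y : Y) (f : hom x y) :
  section_map y ∘ f = fmap L (fmap (kz_eta K Y) f) ∘ section_map x.
Proof.
apply: eta_inj; rewrite !fmap_comp !section_mapE.
exact: (ncompE eta (fmap (kz_eta K Y) f)).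
Qed.
Definition section_trans : nat_trans (functor_id Y) (functor_comp L (kz_eta K Y)) :=
  @NatTrans _ _ (functor_id Y) (functor_comp L (kz_eta K Y)) section_map section_map_nat.

Lemma section_map_iso (y : Y) : is_iso (section_map y).
Proof.
(* [e] is the counit, the transpose of the identity. *)
have [e [ee _]] := etaU (idm (kz_eta K Y y)); exists e.
have es : e ∘ section_map y = idm y.
  by apply: eta_inj; rewrite fmap_comp section_mapE ee fmap_id.
split=> //; have [k [_ ku]] := etaU (eta (kz_eta K Y y)).
rewrite -(ku (idm _)) ?fmap_id ?comp_idl // (ku (section_map y ∘ e)) //.
by rewrite fmap_comp -compA ee comp_idr section_mapE.
Qed.

(** A left adjoint preserves coequalizers, and [section_map] identifies [L] of a unit object with
    the object of [Y] it comes from. *)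
Lemma adjoint_coequalizer (a b : Y) (u v : hom a b) (A : kz_cat K Y)
    (p : hom (kz_eta K Y b) A) :
  is_coequalizer (fmap (kz_eta K Y) u) (fmap (kz_eta K Y) v) p ->
  is_coequalizer u v (fmap L p ∘ section_map b).
Proof.
move=> [pe pu].
have LpE : fmap (kz_eta K Y) (fmap L p ∘ section_map b) = eta A ∘ p.
  by rewrite fmap_comp section_mapE; apply/esym/(ncompE eta p).
split=> [|W g guv].
  by apply: eta_inj; rewrite [LHS]fmap_comp [RHS]fmap_comp LpE -2!compA pe.
have [|h [hp hu]] := pu _ (fmap (kz_eta K Y) g); first by rewrite -!fmap_comp guv.
have [k [kh ku]] := etaU h; exists k; split=> [|l lg].
  by apply: eta_inj; rewrite fmap_comp LpE compA kh hp.
by apply/ku/esym/hu; rewrite -compA -LpE -fmap_comp lg.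
Qed.

Section Extension.
Variables (X : lex_category) (f : lex_functor X Y).
Definition adj_ext : lex_functor (kz_cat K X) Y := lex_comp L (kz_map K f).
Lemma adj_cell_nat (x y : X) (u : hom x y) :
  (fmap L (kz_cell K f y) ∘ section_map (f y)) ∘ fmap f u =
  fmap (functor_comp adj_ext (kz_eta K X)) u ∘ (fmap L (kz_cell K f x) ∘ section_map (f x)).
Proof.
rewrite -compA section_map_nat !compA. rewrite -!fmap_comp.
by have /= -> := ncompE (kz_cell K f) u.
Qed.
Definition adj_cell : nat_trans f (functor_comp adj_ext (kz_eta K X)) :=
  @NatTrans _ _ f (functor_comp adj_ext (kz_eta K X))
    (fun x => fmap L (kz_cell K f x) ∘ section_map (f x)) adj_cell_nat.

Lemma adj_quotient_lan : quotient_lan adj_cell.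
Proof.
move=> A /=; rewrite compA -fmap_comp.
exact/adjoint_coequalizer/pr_map_quot.
Qed.

Definition adj_lan : @lan Lex X (kz_cat K X) Y (kz_eta K X) f :=
  lan_of_pointwise (quotient_lan_pointwise adj_quotient_lan).

Lemma adj_lan_inv : invertible (lan_cell adj_lan).
Proof.
apply/(is_iso_invertible (F := f) (G := lex_comp adj_ext (kz_eta K X))) => x /=.
by apply: is_iso_comp (section_map_iso _); apply/is_iso_fmap/kz_cell_iso.
Qed.
End Extension.

(** The comparison cell is the image under [L] of the invertible comparison for [kz_map] of a
    composite. *)
Lemma adj_lan_comp (X X' : lex_category) (f : lex_functor X Y) (g : lex_functor X' X) :
  invertible (lan_precomp_cell (B := Lex) (i := kz_unit K) (adj_lan (lex_comp f g))
    (adj_lan f) (kz_mor K g)).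
Proof.
have [a [aI aE]] := kz_map_comp K f g.
pose b : nat_trans (adj_ext (lex_comp f g)) (functor_comp (adj_ext f) (kz_map K g)) :=
  @NatTrans _ _ (adj_ext (lex_comp f g)) (functor_comp (adj_ext f) (kz_map K g))
  (fun A => fmap L (a A)) (fun A B u => ncompE (nat_lwhisker L a) u).
apply: (@lan_desc_invertible Lex _ _ _ _ _ (adj_lan (lex_comp f g))
  (lex_comp (adj_ext f) (kz_map K g)) _ b).
  apply: nat_trans_ext => x /=; rewrite !comp_idr comp_idl !compA -!fmap_comp.
  by congr (_ ∘ _); congr (fmap L _); apply: aE.
apply/(is_iso_invertible (F := adj_ext (lex_comp f g))
  (G := lex_comp (adj_ext f) (kz_map K g))).
by move=> A; apply: (is_iso_fmap L (aI A)).
Qed.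

Definition adj_algebra : kz_algebra K Y :=
  @KZAlgebra Lex K Y adj_lan adj_lan_inv adj_lan_comp.
End Adjoint.

Lemma cocompleteP (Y : lex_category) : cocomplete K Y <-> lex_left_adjoint (kz_eta K Y).
Proof.
split=> [|[L [eta etaU]]]; first exact: cocomplete_adjoint.
by constructor; apply: adj_algebra etaU.
Qed.

(** An arbitrary algebra structure agrees with the one built from the adjoint, as Kan extensions are
    unique up to isomorphism; the coequalizer property is carried along that isomorphism. *)
Lemma alg_ext_quotient_lan (X Y : lex_category) (alg : kz_algebra K Y) (f : lex_functor X Y) :
  @quotient_lan X Y f (lan_mor (alg_ext alg f)) (lan_cell (alg_ext alg f)).
Proof.
have /cocompleteP [L [eta etaU]] : cocomplete K Y by [].
have M := adj_quotient_lan etaU f.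
pose l := adj_lan etaU f; pose E := alg_ext alg f.
pose a := lan_desc l (lan_cell E); pose b := lan_desc E (lan_cell l).
have aE x := congr1 (fun c : nat_trans _ _ => c x) (lan_fac l (lan_cell E)).
have bE x := congr1 (fun c : nat_trans _ _ => c x) (lan_fac E (lan_cell l)).
have aI A : is_iso (a A).
  exists (b A); split.
    apply: (lex_lan_ext (l := l) (a := nat_comp b a) (b := nat_id _)) => x.
    by rewrite /= comp_idl -compA; rewrite /= in aE bE; rewrite aE bE.
  apply: (lex_lan_ext (l := E) (a := nat_comp a b) (b := nat_id _)) => x.
  by rewrite /= comp_idl -compA; rewrite /= in aE bE; rewrite bE aE.
move=> A; have := coequalizer_iso (M A) (aI A).
rewrite compA; have /= -> := ncompE a (pr_quot R A).
by rewrite -compA; have /= -> := aE (ob0 (pr_gpd R A)).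
Qed.

(** At [A], the comparison cell goes from the coequalizer in [Y] of the image of the presenting pair
    to the image under [f] of its coequalizer in [X]. It is invertible exactly when the latter is
    again a coequalizer. *)
Lemma linearP (X Y : lex_category) (algX : kz_algebra K X) (algY : kz_algebra K Y)
    (f : lex_functor X Y) :
  linear algX algY f <-> forall A : kz_cat K X, preserves_quotient f (pr_gpd R A).
Proof.
pose E := alg_ext algY f; pose M := alg_mul algX.
have EU := alg_ext_quotient_lan algY f.
have MU : @quotient_lan X X (lex_id X) (lan_mor M) (lan_cell M).
  exact: alg_ext_quotient_lan.
pose k := lan_postcomp_cell E M.
have kE (A : kz_cat K X) : k A ∘ (fmap (lan_mor E) (pr_quot R A) ∘ lan_cell E _) =
    fmap f (fmap (lan_mor M) (pr_quot R A) ∘ lan_cell M _).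
  rewrite compA; have /= -> := ncompE k (pr_quot R A).
  rewrite -compA fmap_comp; congr (_ ∘ _).
  have := congr1 (fun c : nat_trans _ _ => c (ob0 (pr_gpd R A)))
    (lan_fac E (g := lex_comp f (lan_mor M)) (assoc _ _ _ • (_ ◁ lan_cell M) • runitorV _)%bicat).
  by rewrite /= comp_idl comp_idr.
transitivity (forall A : kz_cat K X, is_iso (k A)).
  exact: (is_iso_invertible (F := lan_mor E) (G := lex_comp f (lan_mor M))).
split=> kI A => [Q q cq|].
  have [i iI ->] := coequalizer_unique (MU A) cq.
  rewrite fmap_comp; apply: coequalizer_iso (is_iso_fmap _ iI).
  by rewrite -kE; apply: coequalizer_iso (kI A); apply: EU.
apply: (iso_of_coequalizers (EU A)).
by rewrite kE; apply: kI; apply: MU.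
Qed.
End Presented.

(** * The presentations of the two machines and the inclusion between them *)

Lemma unit_map_ff (X : lex_category) (x y : X)
    (g : @hom (Eh2_cat X) (unit_obj x) (unit_obj y)) : exists! t, Eh2_unit_map t = g.
Proof.
have [{}g ->] := hclassW g; exists (hom0 g); split; first exact: hclass_eq.
by move=> t /hclassP /related_unit.
Qed.

Lemma Eh_act_quotient_coequalizer (X Z : lex_category) (f : lex_functor X Z) (A : Eh X) :
  @is_coequalizer (Eh Z) _ _ (Eh_act f A) (fmap (Eh_eta Z) (fmap f (d0 (sval A))))
    (fmap (Eh_eta Z) (fmap f (d1 (sval A))))
    (act_map f (hclass (quotient_hom (sval A))) ∘ hclass (act_unit_hom f (ob0 (sval A)))).
Proof.
have [e U] := act_quotient_coequalizer f (sval A); split; first exact: e.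
by move=> -[W mW]; apply: U.
Qed.

Definition Eh2_presentation : presentation Eh2_machine :=
  @Presentation Eh2_machine (fun X A => A)
    (fun X A => hclass (quotient_hom A)) (fun X A => quotient_hom_coeq A)
    (fun X A x p => quotient_hom_lift p) (fun X Z f A => act_quotient_coequalizer f A)
    unit_map_ff.

Definition Eh_presentation : presentation Eh_machine :=
  @Presentation Eh_machine (fun X A => sval A)
    (fun X A => hclass (quotient_hom (sval A))) (fun X A => quotient_hom_coeq (sval A))
    (fun X A x p => quotient_hom_lift p) Eh_act_quotient_coequalizer unit_map_ff.

Section Inclusion.
Variable C : lex_category.

Definition Eh_incl : functor (Eh C) (Eh2 C) :=
  @Functor (Eh C) (Eh2 C) (fun A => sval A) (fun _ _ f => f)
    (fun _ => erefl) (fun _ _ _ _ _ => erefl).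

Lemma Eh_incl_lex : preserves_finite_limits Eh_incl.
Proof.
apply: preserves_of_pullbacks => [|A B E f g].
  have [t tt] := terminal_obj C; exists (Eh_unit C t); split=> [B|].
    exact: (@Eh2_terminal C (unit_obj t) tt (sval B)).
  exact: (@Eh2_terminal C (unit_obj t) tt).
have [P [PP _ mP]] := @Eh2_fun_pullback _ _ (lex_id C) (sval A) (sval B) (sval E) f g.
eexists; split; first exact: (full_subcategory_pullback (mP (svalP A) (svalP B)) PP).
by move: PP; rewrite /Eh_incl /fmap_span /=; case: P mP.
Qed.

(** Restrict the left adjoint along the lex inclusion [Eh_incl]: unit objects are equivalence
    groupoids and the subcategory is full, so the universal property is unchanged. *)
Lemma Eh2_adjoint_Eh : lex_left_adjoint (Eh2_eta C) -> lex_left_adjoint (Eh_eta C).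
Proof.
move=> [L [eta etaU]].
exists (@LexFunctor (Eh C) C _ (functor_comp_lex (lex_funP L) Eh_incl_lex)).
exists (@NatTrans (Eh C) (Eh C) (functor_id (Eh C))
  (functor_comp (Eh_eta C) (functor_comp L Eh_incl))
  (fun A => eta (sval A)) (fun A B f => ncompE eta (f : @hom (Eh2_cat C) _ _))).
by move=> A; apply: etaU.
Qed.
End Inclusion.

(** * Exactness *)

(** Only one triangle of the diagonal filler is demanded; the other, [v ∘ q = u], follows because
    [m] is monic. *)
Definition strong_epi (C : category) (b c : C) (q : hom b c) :=
  (forall w (g h : hom c w), g ∘ q = h ∘ q -> g = h) /\
  forall x y (m : hom x y) (z : hom c y) (u : hom b x),
    monic m -> m ∘ u = z ∘ q -> exists v, m ∘ v = z.

(** A stable form of being a cover: every generalized element of [c] lifts along [q] after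
    restriction along some strong epimorphism. *)
Definition locally_lifts (C : category) (b c : C) (q : hom b c) :=
  forall w (z : hom w c), exists v (e : hom v w) (x : hom v b), strong_epi e /\ q ∘ x = z ∘ e.

Lemma coequalizer_strong_epi (C : category) (a b c : C) (u v : hom a b) (q : hom b c) :
  is_coequalizer u v q -> strong_epi q.
Proof.
move=> cq; have [qe qu] := cq; split=> [|x y m z t mm mt]; first exact: coequalizer_epi cq.
have [|k [kq _]] := qu x t; first by apply: mm; rewrite !compA mt -!compA qe.
by exists k; apply: (coequalizer_epi cq); rewrite -compA kq.
Qed.

Lemma strong_epi_comp (C : category) (x y z : C) (g : hom y z) (f : hom x y) :
  strong_epi g -> strong_epi f -> strong_epi (g ∘ f).
Proof.
move=> [ge gs] [fe fs]; split=> [w h k|s t m h u mm].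
  by rewrite !compA => /fe/ge.
by rewrite compA => /(fs _ _ _ _ _ mm) [v mv]; apply: gs mv.
Qed.

Lemma is_iso_pullback (C : category) (x y z : C) (f : hom x z) (g : hom y z) (s : span x y) :
  is_pullback f g s -> is_iso g -> is_iso (sfst s).
Proof.
move=> [sc su] [h [hg gh]].
have [|u [[u1 u2] _]] := su x (idm x) (h ∘ f); first by rewrite compA gh comp_idl comp_idr.
exists u; split=> //; have [k [_ ku]] := su s (sfst s) (ssnd s) sc.
rewrite -(ku (idm _)); last by rewrite !comp_idr.
apply/esym/ku; split; rewrite compA ?u1 ?u2 ?comp_idl //.
by rewrite -compA sc compA hg comp_idl.
Qed.

Lemma is_iso_cancel (C : category) (x y : C) (f : hom x y) : is_iso f ->
  forall w (u v : hom w x), f ∘ u = f ∘ v -> u = v.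
Proof.
by move=> [g [gf _]] w u v e; rewrite -[u]comp_idl -[v]comp_idl -gf -!compA e.
Qed.

(* Barr exactness, with effectiveness of equivalence relations and stability of
   regular epimorphisms stated on generalized elements. *)
Definition exact_category (Y : lex_category) :=
  forall A : eqv_2gpd Y, eqv_gpd A -> exists Q (q : hom (ob0 A) Q),
  [/\ is_coequalizer (d0 A) (d1 A) q, locally_lifts q &
      forall w (x y : hom w (ob0 A)), q ∘ x = q ∘ y -> related x y].

(** * Exactness from a lex left adjoint of the unit *)

Section ExactOfAdjoint.
Variables (Y : lex_category) (L : lex_functor (Eh Y) Y).
Variable eta : nat_trans (functor_id (Eh Y)) (functor_comp (Eh_eta Y) L).
Hypothesis etaU : forall A W (g : hom A (Eh_eta Y W)),
  exists! k : hom (L A) W, fmap (Eh_eta Y) k ∘ eta A = g.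

Let th : nat_trans (functor_id Y) (functor_comp L (Eh_eta Y)) :=
  @section_trans Eh_machine Eh_presentation Y L eta.

Let thI y : is_iso (th y).
Proof. exact: (@section_map_iso Eh_machine Eh_presentation Y L eta etaU). Qed.

Let quot (A : Eh Y) : hom (Eh_eta Y (ob0 (sval A))) A := hclass (quotient_hom (sval A)).

Definition adj_quot (A : Eh Y) : hom (ob0 (sval A)) (L A) := fmap L (quot A) ∘ th _.

Lemma adj_quot_coequalizer (A : Eh Y) :
  is_coequalizer (d0 (sval A)) (d1 (sval A)) (adj_quot A).
Proof.
apply: (@adjoint_coequalizer Eh_machine Eh_presentation Y L eta etaU).
have [e U] := @quotient_coequalizer Y (sval A) (quotient_hom (sval A)) erefl.
by split; [exact: e | move=> -[W mW]; apply: U].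
Qed.

Lemma adj_quot_nat (A B : Eh Y) (f : hom A B) (x : hom (ob0 (sval A)) (ob0 (sval B))) :
  f ∘ quot A = quot B ∘ fmap (Eh_eta Y) x -> adj_quot B ∘ x = fmap L f ∘ adj_quot A.
Proof.
move=> e; rewrite /adj_quot compA -fmap_comp e fmap_comp -!compA.
by congr (_ ∘ _); apply: (ncompE th x).
Qed.

(** Both maps are transposes of the same arrow. As [th] is invertible, [L] therefore inverts the
    unit [eta], which is what the stability of quotients rests on. *)
Lemma fmap_adj_unit (A : Eh Y) : fmap L (eta A) = th (L A).
Proof.
have [k [_ ku]] := etaU (eta (Eh_eta Y (L A)) ∘ eta A).
rewrite -(ku (th (L A))); last first.
  by congr (_ ∘ _); apply: (@section_mapE Eh_machine Eh_presentation Y L eta).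
by apply/esym/ku/esym; apply: (ncompE eta (eta A)).
Qed.

(** Pull [eta A] back along the image of [z], inside [Eh Y]. As [L] preserves this pullback and
    inverts [eta A], it sends the new vertex [P] to a copy of [W], and the quotient map of [P] is
    the desired cover. *)
Lemma adj_quot_locally_lifts (A : Eh Y) : locally_lifts (adj_quot A).
Proof.
move=> W z.
have [s ps] := lex_pullback (lex_catP (Eh Y)) (fmap (Eh_eta Y) z)
  (eta A : hom A (Eh_eta Y (L A))).
pose P : Eh Y := sapex s.
have Lps := preserves_pullback (lex_funP L) ps.
have I1 : is_iso (fmap L (sfst s)).
  by apply: (is_iso_pullback Lps); rewrite fmap_adj_unit; apply: thI.
have [h [hth thh]] := thI W.
(* The lift is found upstairs: every map from a unit object to [A] factors through the object part
   of [A]. *)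
have [t tE] := quotient_hom_lift (ssnd s ∘ quot P).
exists (ob0 (sval P)), (h ∘ (fmap L (sfst s) ∘ adj_quot P)), t; split.
  rewrite compA; apply: coequalizer_strong_epi.
  apply: coequalizer_iso (adj_quot_coequalizer P) _.
  by apply: is_iso_comp I1; exists (th W).
apply: (is_iso_cancel (thI (L A))).
rewrite (adj_quot_nat tE) -[in LHS]fmap_adj_unit.
have /= zE := ncompE th z.
rewrite (compA (th (L A))) zE -(compA _ (th W)) (compA (th W)) thh comp_idl.
by rewrite !compA; have /= -> := proj1 Lps.
Qed.

(** In [Eh Y] the pair [d0, d1] is the kernel pair of the quotient map onto [A]; as [L] preserves
    pullbacks, it is one in [Y] too. *)
Lemma adj_quot_effective (A : Eh Y) w (x y : hom w (ob0 (sval A))) :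
  adj_quot A ∘ x = adj_quot A ∘ y -> related x y.
Proof.
move=> xy.
have pq : is_pullback (quot A) (quot A) (@Span (Eh Y) _ _ (Eh_eta Y (ob1 (sval A)))
    (fmap (Eh_eta Y) (d0 (sval A))) (fmap (Eh_eta Y) (d1 (sval A)))).
  apply: (@full_subcategory_pullback (Eh2_cat Y) (@eqv_gpd Y) (Eh_unit Y (ob0 (sval A)))
    (Eh_unit Y (ob0 (sval A))) A _ _ (@Span (Eh2_cat Y) _ _ (unit_obj (ob1 (sval A)))
    (Eh2_unit_map (d0 (sval A))) (Eh2_unit_map (d1 (sval A)))) (@unit_eqv_gpd Y _)).
  apply: Eh2_pullback => /= [|v a b|v s t /related_unit s0 /related_unit s1].
  - by rewrite !comp_idl; apply: related_d.
  - by rewrite !comp_idl.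
  (* The pullback has the unit object on [ob1] as vertex only because [(d0, d1)] is monic. *)
  apply/(@related_unit Y (ob1 (sval A))); apply: (svalP A).
  by rewrite !pairing_comp s0 s1.
have [_ U] := preserves_pullback (lex_funP L) pq.
have [|k [[k0 k1] _]] := U w (th _ ∘ x) (th _ ∘ y).
  by rewrite !compA.
have [h [_ thh]] := thI (ob1 (sval A)).
have thk : th (ob1 (sval A)) ∘ (h ∘ k) = k by rewrite compA thh comp_idl.
exists (h ∘ k); split; apply: (is_iso_cancel (thI _)); rewrite compA.
  by have /= -> := ncompE th (d0 (sval A)); rewrite -compA thk.
by have /= -> := ncompE th (d1 (sval A)); rewrite -compA thk.
Qed.
End ExactOfAdjoint.

Lemma adjoint_exact (Y : lex_category) : lex_left_adjoint (Eh_eta Y) -> exact_category Y.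
Proof.
move=> [L [eta etaU]] A mA; pose A' : Eh Y := exist _ A mA.
exists (L A'), (adj_quot eta A'); split.
- exact: (adj_quot_coequalizer etaU A').
- exact: (adj_quot_locally_lifts etaU (A := A')).
by move=> w x y; apply: (adj_quot_effective etaU (A := A')).
Qed.

(** * Kernel pairs as equivalence groupoids *)

Section KernelPair.
Variables (C : lex_category) (x y : C) (f : hom x y).

Lemma kernel_lift w (a b : hom w x) : f ∘ a = f ∘ b ->
  exists k, sfst (pullback f f) ∘ k = a /\ ssnd (pullback f f) ∘ k = b.
Proof. by move=> /(proj2 (pullbackP f f)) [k [kE _]]; exists k. Qed.

Lemma kernel_eq w (k : hom w (pullback f f)) :
  f ∘ (sfst (pullback f f) ∘ k) = f ∘ (ssnd (pullback f f) ∘ k).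
Proof. by rewrite !compA (proj1 (pullbackP f f)). Qed.

Lemma kernel_sym : exists g : hom (pullback f f) (pullback f f),
  sfst (pullback f f) ∘ g = ssnd (pullback f f) /\
  ssnd (pullback f f) ∘ g = sfst (pullback f f).
Proof. by apply: kernel_lift; rewrite (proj1 (pullbackP f f)). Qed.

Lemma kernel_trans w (a b : hom w (pullback f f)) :
  ssnd (pullback f f) ∘ a = sfst (pullback f f) ∘ b ->
  exists c, sfst (pullback f f) ∘ c = sfst (pullback f f) ∘ a /\
    ssnd (pullback f f) ∘ c = ssnd (pullback f f) ∘ b.
Proof. by move=> e; apply: kernel_lift; rewrite kernel_eq e kernel_eq. Qed.

Definition kernel_gpd : eqv_2gpd C :=
  mk_2gpd (kernel_lift (erefl (f ∘ idm x))) kernel_sym kernel_trans.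

Lemma kernel_eqv_gpd : eqv_gpd kernel_gpd.
Proof.
move=> w u v; rewrite !pairing_comp => /pairing_eq [/= e0 e1].
have [k [_ kk]] := proj2 (pullbackP f f) _ _ _ (kernel_eq v).
by rewrite -(kk v) // -(kk u).
Qed.

Lemma kernel_related w (a b : hom w x) : related (A := kernel_gpd) a b <-> f ∘ a = f ∘ b.
Proof. by split=> [[k [/= <- <-]]|/kernel_lift]; first exact: kernel_eq. Qed.
End KernelPair.

(** * Images and quotients of equivalence 2-groupoids in an exact category *)

Section Exact.
Variables (Y : lex_category) (exY : exact_category Y).

(** The image is the quotient of the kernel pair of [f]. Two elements of it with the same image in
    [y] lift locally to elements of [x] related by the kernel pair, hence are equal. *)
Lemma exact_image (x y : Y) (f : hom x y) : exists r (e : hom x r) (m : hom r y),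
  [/\ m ∘ e = f, monic m, locally_lifts e &
      is_coequalizer (d0 (kernel_gpd f)) (d1 (kernel_gpd f)) e].
Proof.
have [r [e [ce le ee]]] := exY (@kernel_eqv_gpd Y x y f).
have [m [me _]] := proj2 ce _ f (proj1 (pullbackP f f)).
exists r, e, m; split=> // w u v muv.
have [w1 [c1 [u' [s1 eu]]]] := le w u.
have [w2 [c2 [v' [s2 ev]]]] := le w1 (v ∘ c1).
apply: (proj1 s1); apply: (proj1 s2); rewrite -eu -ev -compA.
have /(@kernel_related Y _ _ f) [k [<- <-]] : f ∘ (u' ∘ c2) = f ∘ v'.
  by rewrite -me -!compA ev (compA e) eu !compA muv.
by rewrite !compA (proj1 ce).
Qed.

(* The image of [A_1 -> A_0 * A_0] is an equivalence relation. *)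
Lemma exact_support (A : eqv_2gpd Y) :
  exists (r : Y) (e : hom (ob1 A) r) (r0 r1 : hom r (ob0 A)) refl sym trans,
  [/\ r0 ∘ e = d0 A, r1 ∘ e = d1 A, locally_lifts e,
      is_coequalizer (d0 (kernel_gpd (pairing (d0 A) (d1 A))))
        (d1 (kernel_gpd (pairing (d0 A) (d1 A)))) e &
      eqv_gpd (@mk_2gpd Y (ob0 A) r r0 r1 refl sym trans)].
Proof.
have [r [e [m [me mm le ce]]]] := exact_image (pairing (d0 A) (d1 A)).
pose r0 := sfst _ ∘ m; pose r1 := ssnd _ ∘ m.
have mE : pairing r0 r1 = m by apply: product_ext; rewrite ?pairing_fst ?pairing_snd.
have e0 : r0 ∘ e = d0 A by rewrite -compA me pairing_fst.
have e1 : r1 ∘ e = d1 A by rewrite -compA me pairing_snd.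
have lift w (x y : hom w (ob0 A)) : related x y -> exists c : hom w r, r0 ∘ c = x /\ r1 ∘ c = y.
  by move=> [h [<- <-]]; exists (e ∘ h); rewrite !compA e0 e1.
(* Membership in the image relation is local: a strong epimorphism lifts against the mono [m]. *)
have desc v w (c : hom v w) (x y : hom w (ob0 A)) : strong_epi c ->
    related (x ∘ c) (y ∘ c) -> exists k : hom w r, r0 ∘ k = x /\ r1 ∘ k = y.
  move=> [_ sc] /lift [k [k0 k1]].
  have [|l lE] := sc _ _ _ (pairing x y) k mm.
    by rewrite -mE !pairing_comp k0 k1.
  by exists l; move: lE; rewrite -mE pairing_comp => /pairing_eq.
(* Conversely, an element of the image relation comes locally from [ob1 A]. The laws of [A] are
   applied there and descended by [desc]. *)
have loc w (k : hom w r) : exists v (c : hom v w) (h : hom v (ob1 A)),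
    [/\ strong_epi c, d0 A ∘ h = r0 ∘ k ∘ c & d1 A ∘ h = r1 ∘ k ∘ c].
  have [v [c [h [sc hE]]]] := le w k; exists v, c, h.
  by rewrite -e0 -e1 -!compA hE.
have refl : exists g : hom (ob0 A) r, r0 ∘ g = idm _ /\ r1 ∘ g = idm _.
  exact/lift/related_refl.
have sym : exists g : hom r r, r0 ∘ g = r1 /\ r1 ∘ g = r0.
  have [v [c [h [sc h0 h1]]]] := loc _ (idm r).
  apply: (desc _ _ c) => //; apply: related_sym; exists h.
  by rewrite h0 h1 !comp_idr.
have trans w (a b : hom w r) : r1 ∘ a = r0 ∘ b ->
    exists c : hom w r, r0 ∘ c = r0 ∘ a /\ r1 ∘ c = r1 ∘ b.
  move=> ab; have [v [c [h [sc h0 h1]]]] := loc _ a.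
  have [v' [c' [h' [sc' h0' h1']]]] := loc _ (b ∘ c).
  apply: (desc _ _ (c ∘ c')); first exact: strong_epi_comp.
  apply: (@related_trans _ _ _ _ (r1 ∘ a ∘ (c ∘ c'))).
    by exists (h ∘ c'); rewrite !compA h0 h1.
  by exists h'; rewrite h0' h1' ab !compA.
exists r, e, r0, r1, refl, sym, trans; split=> //.
by rewrite /eqv_gpd /= mE.
Qed.

(** Since [e] is epic, [A] and its image relation have the same coequalizer. Effectiveness holds
    only up to a cover, as elements of the image lift to [ob1 A] only locally. *)
Lemma exact_quotient (A : eqv_2gpd Y) : exists Q (q : hom (ob0 A) Q),
  [/\ is_coequalizer (d0 A) (d1 A) q, locally_lifts q &
      forall w (x y : hom w (ob0 A)), q ∘ x = q ∘ y ->
        exists v (c : hom v w), strong_epi c /\ related (x ∘ c) (y ∘ c)].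
Proof.
have [r [e [r0 [r1 [refl [sym [trans [e0 e1 le /coequalizer_strong_epi se mr]]]]]]]] :=
  exact_support A.
have [Q [q [[/= qe qU] lq qr]]] := exY mr.
exists Q, q; split=> //.
  split=> [|w g]; first by rewrite -e0 -e1 !compA qe.
  by rewrite -e0 -e1 !compA => /(proj1 se)/qU.
move=> w x y /qr [k [/= <- <-]]; have [v [c [h [sc hE]]]] := le w k.
exists v, c; split=> //; exists h.
by rewrite -e0 -e1 -!compA hE.
Qed.

Lemma preserves_quotients (Z : lex_category) (f : lex_functor Y Z) :
  (forall A : eqv_2gpd Y, eqv_gpd A -> preserves_quotient f A) ->
  forall A : eqv_2gpd Y, preserves_quotient f A.
Proof.
move=> fP A Q q [qe qU].
have [r [e [r0 [r1 [refl [sym [trans [e0 e1 _ ce mr]]]]]]]] := exact_support A.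
(* [e] is the quotient of a kernel pair, which [f] preserves, so [fmap f e] is still epic and the
   passage between [A] and its image relation survives [f]. *)
have fce := coequalizer_epi (fP _ (@kernel_eqv_gpd _ _ _ _) _ _ ce).
have qr : is_coequalizer r0 r1 q.
  split=> [|w g gr]; last by apply: qU; rewrite -e0 -e1 !compA gr.
  by apply: (coequalizer_epi ce); rewrite -!compA e0 e1.
have [fqe fqU] := fP _ mr _ _ qr; rewrite /= in fqe fqU.
split=> [|w g]; first by rewrite -!fmap_comp qe.
rewrite -e0 -e1 !fmap_comp !compA => /fce; exact: fqU.
Qed.
End Exact.

(** * The quotient functor of an exact category *)

Section QuotientFunctor.
Variables (Y : lex_category) (exY : exact_category Y).
Implicit Types A B D : Eh2 Y.

Definition quo A : Y := sval (cid (exact_quotient exY A)).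
Definition quo_map A : hom (ob0 A) (quo A) := sval (cid (svalP (cid (exact_quotient exY A)))).

Lemma quo_coequalizer A : is_coequalizer (d0 A) (d1 A) (quo_map A).
Proof. by have [] := svalP (cid (svalP (cid (exact_quotient exY A)))). Qed.
Lemma quo_lift A : locally_lifts (quo_map A).
Proof. by have [] := svalP (cid (svalP (cid (exact_quotient exY A)))). Qed.
Lemma quo_effective A w (x y : hom w (ob0 A)) : quo_map A ∘ x = quo_map A ∘ y ->
  exists v (c : hom v w), strong_epi c /\ related (x ∘ c) (y ∘ c).
Proof. by have [_ _] := svalP (cid (svalP (cid (exact_quotient exY A)))); apply. Qed.

Lemma quo_related A w (x y : hom w (ob0 A)) : related x y -> quo_map A ∘ x = quo_map A ∘ y.
Proof. by move=> [h [<- <-]]; rewrite !compA (proj1 (quo_coequalizer A)). Qed.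

Lemma quo_epi A w (g h : hom (quo A) w) : g ∘ quo_map A = h ∘ quo_map A -> g = h.
Proof. exact: coequalizer_epi (quo_coequalizer A) _ _ _. Qed.

Lemma quo_fmap_ex A B (f : hom A B) :
  exists k, k ∘ quo_map A = quo_map B ∘ hom0 (hrepr f).
Proof.
have [|k [kE _]] := proj2 (quo_coequalizer A) _ (quo_map B ∘ hom0 (hrepr f)).
  by rewrite -!compA; apply/quo_related/hom_related.
by exists k.
Qed.
Definition quo_fmap A B (f : hom A B) : hom (quo A) (quo B) := sval (cid (quo_fmap_ex f)).

(** The representative chosen in [quo_fmap] is immaterial, as homotopic morphisms agree after the
    quotient map. *)
Lemma quo_fmapE A B (f : eqv_2gpd_hom A B) :
  quo_fmap (hclass f) ∘ quo_map A = quo_map B ∘ hom0 f.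
Proof.
rewrite /quo_fmap; case: cid => k /= ->; apply/quo_related/hclassP.
exact: hreprK.
Qed.

Lemma quo_fmap_id A : quo_fmap (idm A) = idm (quo A).
Proof. by apply: quo_epi; rewrite (quo_fmapE (eqv_2gpd_id A)) /= comp_idl comp_idr. Qed.

Lemma quo_fmap_comp A B D (g : hom B D) (f : hom A B) :
  quo_fmap (g ∘ f) = quo_fmap g ∘ quo_fmap f.
Proof.
have [{}f ->] := hclassW f; have [{}g ->] := hclassW g.
apply: quo_epi; rewrite hclassE quo_fmapE -compA quo_fmapE compA quo_fmapE.
by rewrite /= compA.
Qed.

Definition quo_functor : functor (Eh2 Y) Y :=
  @Functor (Eh2 Y) Y quo quo_fmap quo_fmap_id quo_fmap_comp.

Section Pullback.
Variables (A B D P : eqv_2gpd Y) (f : eqv_2gpd_hom A D) (g : eqv_2gpd_hom B D).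
Variables (p : eqv_2gpd_hom P A) (q : eqv_2gpd_hom P B).
Hypothesis pb : @is_pullback (Eh2 Y) A B D (hclass f) (hclass g)
  (@Span (Eh2 Y) A B P (hclass p) (hclass q)).

(** Test the pullback on the unit object of [w]: its maps into [A] are the elements of [ob0 A] at
    [w] modulo relatedness. *)
Lemma pullback_eh2_lift w (a : hom w (ob0 A)) (b : hom w (ob0 B)) :
  related (hom0 f ∘ a) (hom0 g ∘ b) ->
  exists x, related (hom0 p ∘ x) a /\ related (hom0 q ∘ x) b.
Proof.
move=> fagb.
have [|a' a'E] := @ex_hom Y (unit_obj w) A a; first exact: related_refl.
have [|b' b'E] := @ex_hom Y (unit_obj w) B b; first exact: related_refl.
have [|u [[ua ub] _]] := proj2 pb (unit_obj w) (hclass a') (hclass b').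
  by rewrite !hclassE; apply/hclassP; rewrite /= a'E b'E.
have [x uE] := hclassW u; move: ua ub; rewrite uE /= !hclassE => /hclassP xa /hclassP xb.
by exists (hom0 x); rewrite -a'E -b'E.
Qed.

Lemma pullback_eh2_related w (x y : hom w (ob0 P)) :
  related (hom0 p ∘ x) (hom0 p ∘ y) -> related (hom0 q ∘ x) (hom0 q ∘ y) -> related x y.
Proof.
move=> px qx.
have [|x' x'E] := @ex_hom Y (unit_obj w) P x; first exact: related_refl.
have [|y' y'E] := @ex_hom Y (unit_obj w) P y; first exact: related_refl.
have [|u [_ uu]] := proj2 pb (unit_obj w) (hclass p ∘ hclass y') (hclass q ∘ hclass y').
  by rewrite !compA; congr (_ ∘ _); apply: (proj1 pb).
rewrite -x'E -y'E; apply: (proj1 (hclassP x' y')); transitivity u; last exact: uu.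
apply/esym/uu; rewrite /= !hclassE; split; apply/hclassP; by rewrite /= x'E y'E.
Qed.

(** Lift [x] and [y] to [ob0 P] over a common cover; after refining it twice, the lifts are related
    in both [A] and [B], hence in [P]. *)
Lemma quo_pullback_monic w (x y : hom w (quo P)) :
  quo_fmap (hclass p) ∘ x = quo_fmap (hclass p) ∘ y ->
  quo_fmap (hclass q) ∘ x = quo_fmap (hclass q) ∘ y -> x = y.
Proof.
move=> px qx.
have [w1 [c1 [x' [s1 xE]]]] := quo_lift x.
have [w2 [c2 [y' [s2 yE]]]] := quo_lift (y ∘ c1).
apply: (proj1 s1); apply: (proj1 s2); rewrite -xE -yE.
have /quo_effective [w3 [c3 [s3 rp]]] :
    quo_map A ∘ (hom0 p ∘ (x' ∘ c2)) = quo_map A ∘ (hom0 p ∘ y').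
  rewrite !(compA (quo_map A)) -!quo_fmapE -!compA yE (compA (quo_map P)) xE.
  by rewrite !compA px.
have /quo_effective [w4 [c4 [s4 rq]]] :
    quo_map B ∘ (hom0 q ∘ (x' ∘ c2 ∘ c3)) = quo_map B ∘ (hom0 q ∘ (y' ∘ c3)).
  rewrite !(compA (quo_map B)) -!quo_fmapE -!compA (compA (quo_map P) y') yE.
  by rewrite (compA (quo_map P) x') xE !compA qx.
apply: (proj1 s3); apply: (proj1 s4); rewrite -!compA; apply: quo_related.
apply: pullback_eh2_related; last by rewrite -!compA in rq.
by have := related_comp c4 rp; rewrite -!compA.
Qed.

Lemma quo_pullback : is_pullback (quo_fmap (hclass f)) (quo_fmap (hclass g))
  (Span (quo_fmap (hclass p)) (quo_fmap (hclass q))).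
Proof.
split=> [|w a b ab].
  by rewrite /= -!quo_fmap_comp; congr quo_fmap; apply: (proj1 pb).
have [w1 [c1 [a' [s1 aE]]]] := quo_lift a.
have [w2 [c2 [b' [s2 bE]]]] := quo_lift (b ∘ c1).
have /quo_effective [w3 [c3 [s3]]] :
    quo_map D ∘ (hom0 f ∘ (a' ∘ c2)) = quo_map D ∘ (hom0 g ∘ b').
  rewrite !(compA (quo_map D)) -!quo_fmapE -!compA bE (compA (quo_map A)) aE.
  by rewrite !compA ab.
rewrite -!compA => /pullback_eh2_lift [x [/quo_related px /quo_related qx]].
(* The local solution [x] descends to [w] by lifting the composite cover against the mono [m]. *)
pose m := pairing (quo_fmap (hclass p)) (quo_fmap (hclass q)).
have mm : monic m.
  move=> v u u'; rewrite !pairing_comp => /pairing_eq []; exact: quo_pullback_monic.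
have [_ lift] := strong_epi_comp s1 (strong_epi_comp s2 s3).
have [|u] := lift _ _ m (pairing a b) (quo_map P ∘ x) mm.
  rewrite !pairing_comp; apply/pairing_eq; rewrite !(compA (quo_fmap _)) !quo_fmapE.
  by rewrite -!compA px qx (compA (quo_map A)) aE (compA (quo_map B)) bE -!compA.
rewrite pairing_comp => /pairing_eq [ua ub]; exists u; split=> // v [/= va vb].
by apply: quo_pullback_monic; rewrite ?ua ?ub.
Qed.
End Pullback.

Lemma quo_functor_lex : preserves_finite_limits quo_functor.
Proof.
apply: preserves_of_pullbacks => [|A B D f g].
  have [t tt] := terminal_obj Y; exists (unit_obj t); split; first exact: Eh2_terminal.
  have [] := quo_coequalizer (unit_obj t).
  (* The quotient of a unit object is that object, so the terminal object is preserved. *)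
  have : is_iso (quo_map (unit_obj t)).
    have [k [kq _]] := proj2 (quo_coequalizer (unit_obj t)) t (idm t) erefl.
    by exists k; split=> //; apply: quo_epi; rewrite -compA kq comp_idl comp_idr.
  move=> [k [kq qk]] _ _ x; have [u [_ uu]] := tt x.
  exists (quo_map (unit_obj t) ∘ u); split=> // v _.
  by rewrite (uu (k ∘ v) I) compA qk comp_idl.
have [[P p q] pb] := lex_pullback (lex_catP (Eh2 Y)) f g.
exists (Span p q); split=> //; rewrite /fmap_span /=.
move: pb; have [{}f ->] := hclassW f; have [{}g ->] := hclassW g.
by have [{}p ->] := hclassW p; have [{}q ->] := hclassW q; apply: quo_pullback.
Qed.

Lemma quo_unit_ex A : exists e : eqv_2gpd_hom A (unit_obj (quo A)), hom0 e = quo_map A.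
Proof. by apply: ex_hom; apply/related_unit/(proj1 (quo_coequalizer A)). Qed.
Definition quo_unit A : hom A (Eh2_eta Y (quo A)) := hclass (sval (cid (quo_unit_ex A))).

Lemma quo_unit_nat A B (f : hom A B) :
  quo_unit B ∘ f = Eh2_unit_map (quo_fmap f) ∘ quo_unit A.
Proof.
have [{}f ->] := hclassW f; rewrite !hclassE; apply: hclass_eq => /=.
by rewrite (svalP (cid (quo_unit_ex A))) (svalP (cid (quo_unit_ex B))) quo_fmapE.
Qed.

(** Relatedness in a unit object is equality, so a morphism from [A] to the unit object on [W] is a
    map [ob0 A] to [W] coequalizing [d0] and [d1]; the universal property of [quo] is the
    adjunction. *)
Lemma exact_adjoint : lex_left_adjoint (Eh2_eta Y).
Proof.
exists (@LexFunctor (Eh2 Y) Y quo_functor quo_functor_lex).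
exists (@NatTrans (Eh2 Y) (Eh2 Y) (functor_id (Eh2 Y)) (functor_comp (Eh2_eta Y) quo_functor)
  quo_unit quo_unit_nat).
move=> A W g; have [{}g ->] := hclassW g.
have [|k [kE ku]] := proj2 (quo_coequalizer A) W (hom0 g).
  exact/related_unit/hom_related.
exists k; split.
  by rewrite /= hclassE; apply: hclass_eq; rewrite /= (svalP (cid (quo_unit_ex A))).
move=> l /=; rewrite hclassE => /hclassP /related_unit.
by rewrite /= (svalP (cid (quo_unit_ex A))) => /ku.
Qed.
End QuotientFunctor.

Lemma adjoint_iff (Y : lex_category) :
  lex_left_adjoint (Eh_eta Y) <-> lex_left_adjoint (Eh2_eta Y).
Proof. by split=> [/adjoint_exact/exact_adjoint|/Eh2_adjoint_Eh]. Qed.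

Theorem proposition29 : Morita_equivalent Eh_machine Eh2_machine.
Proof.
split=> [Y|X Y algX algY algX' algY' f].
  transitivity (lex_left_adjoint (Eh_eta Y)); first exact: (cocompleteP Eh_presentation).
  transitivity (lex_left_adjoint (Eh2_eta Y)); first exact: adjoint_iff.
  exact: (iff_sym (cocompleteP Eh2_presentation Y)).
(* Preservation is extended from relations to 2-groupoids inside the source [X], so its exactness is
   what matters. *)
have exX : exact_category X.
  apply/adjoint_exact/(cocompleteP Eh_presentation); by constructor.
have l1 := linearP Eh_presentation algX algY f.
have l2 := linearP Eh2_presentation algX' algY' f.
apply: (iff_trans l1); apply: iff_sym; apply: (iff_trans l2); split=> H.
  by move=> -[A mA]; apply: (H A).
by apply: (preserves_quotients exX) => A mA; apply: (H (exist _ A mA)).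
Qed.
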